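(* Let $X$ be a Haar system space, let $T:L_1(X)\to L_1(X)$ be an $X$-diagonal operator with entries $(T^L)_{L\in\mathcal{D}^+}$, and let $\varepsilon>0$. Assume that for all $L,M\in\mathcal{D}^+$ with $L\subset M$ we have $\|T^L-T^M\|\leq\varepsilon|M|^2$. Then $\|T-T^\emptyset\otimes I\|\leq7\varepsilon$.
   Context: Scalars are real or complex. $\mathcal{D}$ is the set of dyadic intervals $[\frac{i-1}{2^j},\frac i{2^j})$, $j\ge0$, $1\le i\le2^j$; $\mathcal{D}^+=\mathcal{D}\cup\{\emptyset\}$; $I^+,I^-$ are the left and right halves of $I\in\mathcal{D}$; $h_I=\chi_{I^+}-\chi_{I^-}$, $h_\emptyset=\chi_{[0,1)}$. The index $\emptyset$ plays the role of the root (the immediate predecessor of $[0,1)$): $|\emptyset|=1$ by convention, and in the relation $L\subset M$ on $\mathcal{D}^+$, inclusion between intervals is ordinary inclusion, every $L\in\mathcal{D}^+$ satisfies $L\subset\emptyset$, and $\emptyset\subset M$ only for $M=\emptyset$. A Haar system space $X$ is the completion of $Z=\mathrm{span}\{\chi_I:I\in\mathcal{D}\}$ under a norm such that (i) if $f,g\in Z$ and $|f|,|g|$ have the same distribution then $\|f\|=\|g\|$, and (ii) $\|\chi_{[0,1)}\|=1$. $Z$ is identified with a subspace of $X^*$ via $\langle g,f\rangle=\int_0^1 gf$. For $L\in\mathcal{D}^+$ put $\mu_L=\|h_L\|_X^{-1}$, $\nu_L=\|h_L\|_{X^*}^{-1}$. $L_1(X)$ is the Bochner space on $[0,1)$ (isometrically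 the projective tensor product $L_1\otimes_\pi X$); $(f\otimes x)(s)=f(s)x$; $\langle g\otimes x^*,u\rangle=\int_0^1g(s)x^*(u(s))\,ds$. For a bounded operator $T$ on $L_1(X)$ and $L,M\in\mathcal{D}^+$, $T^{(L,M)}:L_1\to L_1$ is the bounded operator with $\langle g,T^{(L,M)}f\rangle=\langle g\otimes\nu_Lh_L,T(f\otimes\mu_Mh_M)\rangle$ for all $g\in L_\infty$, $f\in L_1$; $T^L=T^{(L,L)}$. A bounded operator $T$ on $L_1(X)$ is $X$-diagonal if $T^{(L,M)}=0$ for all $L\ne M$; then $(T^L)_{L\in\mathcal{D}^+}$ are its entries. For bounded $R:L_1\to L_1$, $R\otimes I$ is the bounded operator on $L_1(X)$ with $(R\otimes I)(f\otimes x)=(Rf)\otimes x$. *)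

(* Defs.v *)
From HB Require Import structures.
From mathcomp Require Import all_boot all_order all_algebra.
From mathcomp Require Import complex.
From mathcomp Require Import all_classical all_reals all_analysis.

Set Implicit Arguments.
Unset Strict Implicit.
Unset Printing Implicit Defensive.

Import Order.TTheory GRing.Theory Num.Theory.
Import numFieldNormedType.Exports.

Local Open Scope classical_set_scope.
Local Open Scope ring_scope.

Inductive scalar_kind := RealScalars | ComplexScalars.

Definition scalar_field (R : realType) (k : scalar_kind) : numFieldType :=
  match k with
  | RealScalars => R
  | ComplexScalars => R[i]
  end.

Definition sre (R : realType) (k : scalar_kind) : scalar_field R k -> R :=
  match k with
  | RealScalars => fun z : R => z
  | ComplexScalars => fun z : R[i] => complex.Re z
  end.

Definition of_real (R : realType) (k : scalar_kind) : R -> scalar_field R k :=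
  match k with
  | RealScalars => fun r : R => r
  | ComplexScalars => fun r : R => Complex r 0
  end.

(* Norms of MathComp-Analysis are valued in the scalars (in R[i] for complex
   spaces); [rnorm] is the real number behind such a norm. *)
Definition rnorm (R : realType) (k : scalar_kind)
  (V : normedModType (scalar_field R k)) (x : V) : R := sre `|x|.

Definition snorm (R : realType) (k : scalar_kind) (z : scalar_field R k) : R :=
  sre `|z|.

Section UnitInterval.
Variable R : realType.

Definition unit_itv : set R := `[0, 1[%classic.

Definition scalar_integral (k : scalar_kind) :
    (R -> scalar_field R k) -> scalar_field R k :=
  match k with
  | RealScalars => fun f : R -> R => Rintegral lebesgue_measure unit_itv f
  | ComplexScalars => fun f : R -> R[i] =>
      Complex (Rintegral lebesgue_measure unit_itv (fun s => complex.Re (f s)))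
              (Rintegral lebesgue_measure unit_itv (fun s => complex.Im (f s)))
  end.

(* The code (j, i) stands for [i / 2^j, (i + 1) / 2^j); distinct codes denote
   distinct intervals. [None] is the root index. *)
Definition dyadic_index := {j : nat & 'I_(2 ^ j)}.
Definition haar_index := option dyadic_index.

Definition dyadic_itv (j i : nat) : set R :=
  `[i%:R / 2 ^+ j, i.+1%:R / 2 ^+ j[%classic.

Definition dyadic_set (Q : dyadic_index) : set R :=
  dyadic_itv (tag Q) (tagged Q).

Definition haar_length (L : haar_index) : R :=
  if L is Some Q then (2 ^+ tag Q)^-1 else 1.

Definition haar_sub (L M : haar_index) : Prop :=
  match L, M with
  | _, None => True
  | None, Some _ => False
  | Some Q, Some Q' => dyadic_set Q `<=` dyadic_set Q'
  end.

Section Scalars.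
Variable k : scalar_kind.
Local Notation K := (scalar_field R k).

Definition haar (L : haar_index) : R -> K :=
  match L with
  | None => \1_unit_itv
  | Some Q => fun s => \1_(dyadic_itv (tag Q).+1 (2 * tagged Q)) s
                     - \1_(dyadic_itv (tag Q).+1 (2 * tagged Q).+1) s
  end.

(* Elements of Z are functions on the line vanishing outside [0, 1). *)
Definition dyadic_step (f : R -> K) : Prop :=
  exists (n : nat) (c : 'I_n -> K) (Q : 'I_n -> dyadic_index),
    f = (fun s => \sum_(i < n) c i * \1_(dyadic_set (Q i)) s).

Definition same_abs_distribution (f g : R -> K) : Prop :=
  forall A : set R, measurable A ->
    lebesgue_measure (unit_itv `&` [set s | A (snorm (f s))]) =
    lebesgue_measure (unit_itv `&` [set s | A (snorm (g s))]).

(* X is the completion of Z under the norm f |-> `|J f|; only the values of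
   J on Z matter. *)
Record haar_system_space (X : completeNormedModType K) (J : (R -> K) -> X)
  : Prop := HaarSystemSpace {
  hss_linear : forall (a : K) (f g : R -> K), dyadic_step f -> dyadic_step g ->
    J (fun s => a * f s + g s) = a *: J f + J g ;
  hss_inj : forall f : R -> K, dyadic_step f -> J f = 0 -> f = (fun=> 0) ;
  hss_dense : dense (J @` dyadic_step) ;
  hss_distribution : forall f g : R -> K, dyadic_step f -> dyadic_step g ->
    same_abs_distribution f g -> `|J f| = `|J g| ;
  hss_unit : `|J (\1_unit_itv)| = 1
}.

Section Dual.
Variables (X : completeNormedModType K) (J : (R -> K) -> X).

Definition is_dual_of (g : R -> K) (phi : X -> K) : Prop :=
  [/\ forall (a : K) (x y : X), phi (a *: x + y) = a * phi x + phi y,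
      continuous (phi : X -> K^o) &
      forall f, dyadic_step f ->
        phi (J f) = scalar_integral (fun s => g s * f s)].

(* The element of X^* with which g in Z is identified: the unique continuous
   linear extension of f |-> \int g f from Z to X. *)
Definition dual_of (g : R -> K) : X -> K :=
  xget (fun=> 0) [set phi | is_dual_of g phi].

Definition dual_norm (phi : X -> K) : R :=
  sup [set snorm (phi x) | x in [set x : X | rnorm x <= 1]].

Definition haar_mu (L : haar_index) : K := `|J (haar L)|^-1.

Definition haar_nu (L : haar_index) : K :=
  of_real k (dual_norm (dual_of (haar L)))^-1.

End Dual.

Section Bochner.
Variable V : normedModType K.

Definition simple_function (u : R -> V) : Prop :=
  exists (n : nat) (A : 'I_n -> set R) (x : 'I_n -> V),
    (forall i, measurable (A i)) /\
    u = (fun s => \sum_(i < n) \1_(A i) s *: x i).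

Definition strongly_measurable (u : R -> V) : Prop :=
  exists2 w : nat -> R -> V, (forall n, simple_function (w n)) &
    forall s, unit_itv s -> w n s @[n --> \oo] --> u s.

Definition L1norm (u : R -> V) : \bar R :=
  (\int[lebesgue_measure]_(s in unit_itv) (rnorm (u s))%:E)%E.

(* Representatives are measurable everywhere on [0, 1); their values outside
   [0, 1) are irrelevant. *)
Definition in_L1 (u : R -> V) : Prop :=
  strongly_measurable u /\ (L1norm u < +oo)%E.

Definition ae_eq_fun (u v : R -> V) : Prop :=
  {ae lebesgue_measure, forall s, unit_itv s -> u s = v s}.

End Bochner.

Definition in_Linfty (g : R -> K) : Prop :=
  strongly_measurable (g : R -> K^o) /\
  exists C : R, {ae lebesgue_measure, forall s, unit_itv s -> snorm (g s) <= C}.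

(* Elements of L_1(V) are represented by functions, up to equality a.e. on
   [0, 1); an operator acts on representatives. Linearity (a.e.) and
   boundedness make it pass to the quotient. *)
Record bounded_L1op (V W : normedModType K) (T : (R -> V) -> (R -> W)) : Prop :=
  BoundedL1op {
  L1op_in_L1 : forall u, in_L1 u -> in_L1 (T u) ;
  L1op_linear : forall (a : K) u v, in_L1 u -> in_L1 v ->
    ae_eq_fun (T (fun s => a *: u s + v s)) (fun s => a *: T u s + T v s) ;
  L1op_bounded : exists C : R, forall u, in_L1 u ->
    (L1norm (T u) <= C%:E * L1norm u)%E
}.

Definition L1opnorm (V W : normedModType K) (T : (R -> V) -> (R -> W)) : \bar R :=
  ereal_sup [set L1norm (T u) | u in [set u | in_L1 u /\ (L1norm u <= 1)%E]].

Definition L1op_sub (V W : normedModType K) (T S : (R -> V) -> (R -> W)) :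
  (R -> V) -> (R -> W) := fun u s => T u s - S u s.

Definition tensor (V : normedModType K) (f : R -> K) (x : V) : R -> V :=
  fun s => f s *: x.

Definition pairing (V : normedModType K) (g : R -> K) (phi : V -> K)
  (u : R -> V) : K := scalar_integral (fun s => g s * phi (u s)).

Section Operators.
Variables (X : completeNormedModType K) (J : (R -> K) -> X).

(* [is_entry T L M E] states E = T^(L,M); this determines E f up to a.e.
   equality for every f in L_1. *)
Definition is_entry (T : (R -> X) -> (R -> X)) (L M : haar_index)
    (E : (R -> K^o) -> (R -> K^o)) : Prop :=
  bounded_L1op E /\
  forall g f : R -> K, in_Linfty g -> in_L1 (f : R -> K^o) ->
    scalar_integral (fun s => g s * E f s) =
    pairing g (fun x => haar_nu J L * dual_of J (haar L) x)
      (T (tensor f (haar_mu J M *: J (haar M)))).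

Definition X_diagonal (T : (R -> X) -> (R -> X)) : Prop :=
  bounded_L1op T /\
  forall L M : haar_index, L <> M -> is_entry T L M (fun _ _ => 0).

(* [is_tensor_id E S] states S = E (x) I on L_1(X). *)
Definition is_tensor_id (E : (R -> K^o) -> (R -> K^o))
    (S : (R -> X) -> (R -> X)) : Prop :=
  bounded_L1op S /\
  forall (f : R -> K) (x : X), in_L1 (f : R -> K^o) ->
    ae_eq_fun (S (tensor f x)) (tensor (E f) x).

End Operators.
End Scalars.
End UnitInterval.

(* Main.v *)
Require Import Defs.
From HB Require Import structures.
From mathcomp Require Import all_boot all_order all_algebra.
From mathcomp Require Import complex.
From mathcomp Require Import all_classical all_reals all_analysis.
From mathcomp Require Import measurable_realfun.
From mathcomp Require Import zify ring lra.

Set Implicit Arguments.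
Unset Strict Implicit.
Unset Printing Implicit Defensive.

Import Order.TTheory GRing.Theory Num.Theory.
Import numFieldNormedType.Exports.

Local Open Scope classical_set_scope.
Local Open Scope ring_scope.

(** The space L_1(X) is a projective tensor product, so it is enough to bound
    (T - T^root (x) I)(f (x) z) by 7 eps |f| |z| for f an indicator function and
    z a dyadic step function ([L1opnorm_le_elementary]).

    Haar functionals separate the points of X ([haar_separate]), and the
    normalizations satisfy nu_L mu_L |L| = 1 ([haar_nu_mu]). Hence X-diagonality
    means that T (f (x) h_L) = (T^L f) (x) h_L almost everywhere
    ([diagonal_haar]). Let z be the sum of c_I 1_I over the intervals I of level
    N, and let a_L be the value of T^L f - T^root f at a point of [0, 1). Since
    1_I is 2^-N times the sum of the constant 1 and of the functions
    +- |L|^-1 h_L over the intervals L that strictly contain I, the value of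
    (T - T^root (x) I)(f (x) z) at that point is the sum over I of
    2^-N c_I (sum over L of +- |L|^-1 a_L h_L). Writing a_L = (a_L - a_I) + a_I
    splits it into three parts ([multiplier_bound]):
    - the deviations a_L - a_I. As |h_L| <= 1 in X, they are bounded by the sum
      over I of 2^-N |c_I| times the sum over L of |L|^-1 |a_L - a_I|, where
      |a_L - a_I| has integral at most eps |L|^2 |f|. The lengths |L| are
      distinct powers of 1/2, so this costs 2 eps, because 2^-N times the sum
      of the |c_I| is at most |z| ([step_norm_mean]);
    - the constant - 2^-N (sum of c_I a_I), which costs eps for the same reason;
    - the sum of c_I a_I 1_I. Here a_I is telescoped along the levels, from level
      1 on, and for each level the sum is cut to its intervals, a contraction
      of X ([step_norm_restrict]). The two intervals of level 1 cost eps each,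
      and the 2^(l+1) intervals of level l+1 cost 4^-l eps each, in total less
      than 4 eps.

    The facts about X come from the invariance of the norm under changes of
    signs and under the exchange of the halves of dyadic intervals: the second
    makes conditional expectations on dyadic levels contractive
    ([step_norm_avg]), which gives [local_mean], the norms of the Haar
    functionals and the separation of points. *)

(** * Real and complex scalars *)

Section Scalars.
Variables (R : realType) (k : scalar_kind).
Local Notation K := (scalar_field R k).

Lemma of_real0 : of_real k 0 = 0 :> K. Proof. by case: k. Qed.
Lemma of_real1 : of_real k 1 = 1 :> K. Proof. by case: k. Qed.
Lemma of_realD (a b : R) : of_real k (a + b) = of_real k a + of_real k b.
Proof. by case: k => //=; rewrite /GRing.add /= addr0. Qed.
Lemma of_realN (a : R) : of_real k (- a) = - of_real k a.
Proof. by case: k => //=; rewrite /GRing.opp /= oppr0. Qed.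
Lemma of_realM (a b : R) : of_real k (a * b) = of_real k a * of_real k b.
Proof. by case: k => //=; rewrite /GRing.mul /= !mulr0 mul0r subr0 addr0. Qed.
Lemma of_real_le (a b : R) : (of_real k a <= of_real k b) = (a <= b).
Proof. by case: k => //=; rewrite lecE /= eqxx. Qed.
Lemma of_real_lt (a b : R) : (of_real k a < of_real k b) = (a < b).
Proof. by case: k => //=; rewrite ltcE /= eqxx. Qed.
Lemma of_real_inj : injective (of_real k : R -> K).
Proof. by move=> a b; case: k => //= -[]. Qed.
Lemma of_realV (a : R) : of_real k a^-1 = (of_real k a)^-1.
Proof.
have [->|a0] := eqVneq a 0; first by rewrite invr0 of_real0 invr0.
apply: (@mulfI _ (of_real k a)).
  by rewrite -of_real0; apply: contra_neq a0; exact: of_real_inj.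
rewrite -of_realM divff// of_real1 divff// -of_real0.
by apply: contra_neq a0; exact: of_real_inj.
Qed.

Lemma of_realK (a : R) : sre (of_real k a) = a.
Proof. by case: k. Qed.
Lemma sreK (z : K) : 0 <= z -> of_real k (sre z) = z.
Proof. by case: k z => //= -[a b]; rewrite lecE /= => /andP[/eqP -> _]. Qed.
Lemma sreD (a b : K) : sre (a + b) = sre a + sre b.
Proof. by case: k a b => //= -[? ?] [? ?]. Qed.
Lemma of_real_nat (n : nat) : of_real k n%:R = n%:R :> K.
Proof. by elim: n => [|n IH]; rewrite ?of_real0// !mulrS of_realD of_real1 IH. Qed.
Lemma of_realX (a : R) (n : nat) : of_real k (a ^+ n) = of_real k a ^+ n.
Proof. by elim: n => [|n IH]; rewrite ?of_real1// !exprS of_realM IH. Qed.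
Lemma of_real_norm (V : normedModType K) (x : V) : of_real k (rnorm x) = `|x|.
Proof. by rewrite sreK. Qed.

Lemma rnorm_ge0 (V : normedModType K) (x : V) : 0 <= rnorm x.
Proof. by rewrite -of_real_le of_real_norm of_real0. Qed.
Lemma rnorm0 (V : normedModType K) : rnorm (0 : V) = 0.
Proof. by apply: of_real_inj; rewrite of_real_norm of_real0 normr0. Qed.
Lemma rnorm0_eq0 (V : normedModType K) (x : V) : rnorm x = 0 -> x = 0.
Proof.
by move=> /(congr1 (of_real k)); rewrite of_real_norm of_real0 => /normr0_eq0.
Qed.
Lemma rnormN (V : normedModType K) (x : V) : rnorm (- x) = rnorm x.
Proof. by rewrite /rnorm normrN. Qed.
Lemma rnormB (V : normedModType K) (x y : V) : rnorm (x - y) = rnorm (y - x).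
Proof. by rewrite -rnormN opprB. Qed.
Lemma rnormD (V : normedModType K) (x y : V) : rnorm (x + y) <= rnorm x + rnorm y.
Proof. by rewrite -of_real_le of_realD !of_real_norm ler_normD. Qed.
Lemma rnormZ (V : normedModType K) (a : K) (x : V) :
  rnorm (a *: x) = snorm a * rnorm x.
Proof. by apply: of_real_inj; rewrite of_realM !of_real_norm normrZ. Qed.
Lemma rnorm_sum (V : normedModType K) (I : Type) (s : seq I) (P : pred I) (F : I -> V) :
  rnorm (\sum_(i <- s | P i) F i) <= \sum_(i <- s | P i) rnorm (F i).
Proof.
elim/big_rec2: _ => [|i a b _ h]; first by rewrite rnorm0.
by rewrite (le_trans (rnormD _ _))// lerD2l.
Qed.
Lemma rnorm_subD (V : normedModType K) (x y z : V) :
  rnorm (x - z) <= rnorm (x - y) + rnorm (y - z).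
Proof. by apply: le_trans (rnormD _ _); rewrite addrA subrK. Qed.
Lemma rnorm_lip (V : normedModType K) (x y : V) :
  `|rnorm x - rnorm y| <= rnorm (x - y).
Proof.
rewrite ler_norml; apply/andP; split.
  rewrite lerNl opprB lerBlDl rnormB.
  by rewrite -[X in rnorm X <= _](subrK x) addrC rnormD.
by rewrite lerBlDl -[X in rnorm X <= _](subrK y) addrC rnormD.
Qed.

Lemma snormE (a : K) : snorm a = rnorm (a : K^o). Proof. by []. Qed.
Lemma snormM (a b : K) : snorm (a * b) = snorm a * snorm b.
Proof. exact: (@rnormZ K^o). Qed.
Lemma snorm_of_real (r : R) : snorm (of_real k r) = `|r|.
Proof.
rewrite /snorm; case: (leP 0 r) => r0.
  by rewrite !ger0_norm// ?of_realK// -of_real0 of_real_le.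
by rewrite !ltr0_norm// -?of_realN ?of_realK// -of_real0 of_real_lt.
Qed.
Lemma snorm_ge0 (a : K) : 0 <= snorm a. Proof. exact: (@rnorm_ge0 K^o). Qed.
Lemma snorm1 : snorm (1 : K) = 1.
Proof. by rewrite -of_real1 snorm_of_real normr1. Qed.
Lemma snorm0 : snorm (0 : K) = 0. Proof. exact: (@rnorm0 K^o). Qed.
Lemma snorm0_eq0 (a : K) : snorm a = 0 -> a = 0.
Proof. exact: (@rnorm0_eq0 K^o). Qed.
Lemma snormV (a : K) : snorm a^-1 = (snorm a)^-1.
Proof.
apply: of_real_inj; rewrite of_realV.
by rewrite /snorm !sreK// normfV.
Qed.
Lemma sre_norm_le (z : K) : `|sre z| <= snorm z.
Proof.
rewrite -of_real_le /snorm sreK//; case: k z => z; first by rewrite /=.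
by have := normc_ge_Re z.
Qed.

Lemma cvg_rnormP (V : normedModType K) (w : nat -> V) (l : V) :
  (w n @[n --> \oo] --> l) <->
  (forall e : R, 0 < e -> exists N : nat, forall n, (N <= n)%N -> rnorm (w n - l) < e).
Proof.
split=> [/cvgrPdist_lt h e e0|h].
  have /h [N _ hN] : 0 < of_real k e by rewrite -of_real0 of_real_lt.
  exists N => n /hN /=; rewrite -of_real_norm of_real_lt rnormB; exact.
apply/cvgrPdist_lt => e e0.
have ee : of_real k (sre e) = e by rewrite sreK// ltW.
have /h [N hN] : 0 < sre e by rewrite -of_real_lt ee of_real0.
near=> n.
rewrite -ee distrC -of_real_norm of_real_lt; apply: hN.
by near: n; exists N.
Unshelve. all: by end_near. Qed.

Lemma dense_rnorm (V : normedModType K) (A : set V) : dense A ->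
  forall (x : V) (e : R), 0 < e -> exists2 y, A y & rnorm (x - y) < e.
Proof.
move=> dA x e e0.
have e0' : 0 < of_real k e by rewrite -of_real0 of_real_lt.
have /dA : ball x (of_real k e) !=set0 by exists x; exact: ballxx.
have bo : open (ball x (of_real k e)) by exact: ball_open.
move=> /(_ bo) [y [+ Ay]].
rewrite -ball_normE /= => xy; exists y => //.
by rewrite -of_real_lt of_real_norm.
Qed.

End Scalars.

(** * Simple and strongly measurable functions *)

Section UnitInterval.
Variable R : realType.
Local Notation mu := (@lebesgue_measure R).
Local Notation I01 := (@unit_itv R).

Lemma measurable_unit : measurable I01. Proof. exact: measurable_itv. Qed.
Lemma lebesgue_unit : mu I01 = 1%E.
Proof. by rewrite /unit_itv lebesgue_measure_itv/= lte01 oppr0 adde0. Qed.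

Lemma ae_imp (P Q : R -> Prop) : (forall s, P s -> Q s) ->
  {ae mu, forall s, P s} -> {ae mu, forall s, Q s}.
Proof. exact: (@filterS _ _ (@ae_filter_ringOfSetsType _ _ _ mu)). Qed.

Lemma ae_imp2 (P P' Q : R -> Prop) : (forall s, P s -> P' s -> Q s) ->
  {ae mu, forall s, P s} -> {ae mu, forall s, P' s} -> {ae mu, forall s, Q s}.
Proof. exact: (@filterS2 _ _ (@ae_filter_ringOfSetsType _ _ _ mu)). Qed.
End UnitInterval.
#[global] Hint Resolve measurable_unit : core.
#[global] Hint Extern 0 (measurable (@unit_itv _)) => exact: measurable_unit : core.

Section Components.
Variables (R : realType) (k : scalar_kind).
Local Notation K := (scalar_field R k).

Definition sim : K -> R :=
  match k with
  | RealScalars => fun _ : R => 0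
  | ComplexScalars => fun z : R[i] => complex.Im z
  end.

Lemma scalar_ext (a b : K) : sre a = sre b -> sim a = sim b -> a = b.
Proof. by rewrite /sim; case: k a b => //= -[a a'] [b b'] /= -> ->. Qed.
Lemma simD (a b : K) : sim (a + b) = sim a + sim b.
Proof. by rewrite /sim; case: k a b => [? ?|[? ?] [? ?]] //=; rewrite addr0. Qed.
Lemma sreN (a : K) : sre (- a) = - sre a.
Proof. by case: k a => //= -[? ?]. Qed.
Lemma simN (a : K) : sim (- a) = - sim a.
Proof. by rewrite /sim; case: k a => [? |[? ?]] //=; rewrite oppr0. Qed.
Lemma sreZ (r : R) (a : K) : sre (of_real k r * a) = r * sre a.
Proof. by case: k a => //= -[? ?] /=; rewrite mul0r subr0. Qed.
Lemma simZ (r : R) (a : K) : sim (of_real k r * a) = r * sim a.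
Proof. by rewrite /sim; case: k a => [? |[? ?]] //=; rewrite ?mulr0// mul0r addr0. Qed.
Lemma sim_norm_le (a : K) : `|sim a| <= snorm a.
Proof.
rewrite /sim -(@of_real_le _ k) /snorm sreK//; case: k a => [a|a].
  by rewrite /= normr0.
have -> : complex.Im a = complex.Re (- 'i%C * a) by case: a => x y /=; ring.
apply: le_trans (normc_ge_Re _) _; rewrite normrM normrN.
by rewrite normc_def /= expr0n/= add0r expr1n sqrtr1 mul1r.
Qed.
Lemma snorm_le_comp (a : K) : snorm a <= `|sre a| + `|sim a|.
Proof.
rewrite /sim -(@of_real_le _ k) of_realD /snorm sreK//; case: k a => [a|[a b]].
  by rewrite /= normr0 addr0.
rewrite /= normc_def /=.
have -> : (`|a| +i* 0 + `|b| +i* 0)%C = (`|a| + `|b|)%:C%C.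
  by rewrite /GRing.add /= addr0.
rewrite lecR -(@ler_pXn2r _ 2%N)// ?nnegrE ?addr_ge0// sqr_sqrtr ?addr_ge0 ?sqr_ge0//.
rewrite sqrrD !real_normK ?num_real// addrAC lerDl.
by rewrite mulrn_wge0// mulr_ge0.
Qed.

Lemma sre_scalar_integral (f : R -> K) :
  sre (scalar_integral f) =
  Rintegral lebesgue_measure (@unit_itv R) (fun s => sre (f s)).
Proof. by case: k f. Qed.
Lemma sim_scalar_integral (f : R -> K) :
  sim (scalar_integral f) =
  Rintegral lebesgue_measure (@unit_itv R) (fun s => sim (f s)).
Proof.
by rewrite /sim; case: k f => //= f; rewrite Rintegral_cst// mul0r.
Qed.
Lemma indicK (A : set R) (s : R) : \1_A s = of_real k (\1_A s) :> K.
Proof. by rewrite !indicE of_real_nat. Qed.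
End Components.

Section StrongMeasurability.
Variables (R : realType) (k : scalar_kind).
Local Notation K := (scalar_field R k).
Local Notation mu := (@lebesgue_measure R).
Local Notation I01 := (@unit_itv R).

(** Refining the sets of a simple function to a partition makes every function
    of its values simple; this is what makes compositions measurable. *)
Lemma simple_partition (V : normedModType K) (u : R -> V) : simple_function u ->
  exists (I : finType) (A : I -> set R) (x : I -> V),
    [/\ forall i, measurable (A i), forall s, exists i, A i s,
        forall i j s, A i s -> A j s -> i = j &
        forall i s, A i s -> u s = x i].
Proof.
move=> [n [A [x [mA ->]]]].
pose B (b : {ffun 'I_n -> bool}) : set R := [set s | forall i, b i = (s \in A i)].
exists {ffun 'I_n -> bool}, B,
  (fun b : {ffun 'I_n -> bool} => \sum_(i < n) (b i : nat)%:R *: x i); split.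
- move=> b; rewrite (_ : B b = \bigcap_(i in setT) (if b i then A i else ~` A i)).
    by apply: fin_bigcap_measurable => [|i _]; [exact: finite_finset|]; case: (b i) => //; exact: measurableC.
  apply/seteqP; split=> s /=.
    move=> h i _; rewrite h; case: ifPn; first by rewrite inE.
    by rewrite notin_setE.
  move=> h i; have := h i I; case: (b i) => hs; apply/esym.
    by apply/mem_set.
  by apply/negbTE; rewrite notin_setE.
- by move=> s; exists [ffun i => s \in A i] => i; rewrite ffunE.
- by move=> b c s hb hc; apply/ffunP => i; rewrite hb hc.
- move=> b s hb; apply: eq_bigr => i _; rewrite hb indicE.
  by case: (_ \in _).
Qed.

Lemma simple_of_partition (V : normedModType K) (u : R -> V)
    (I : finType) (A : I -> set R) (x : I -> V) :
  (forall i, measurable (A i)) -> (forall s, exists i, A i s) ->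
  (forall i j s, A i s -> A j s -> i = j) -> (forall i s, A i s -> u s = x i) ->
  simple_function u.
Proof.
move=> mA cA tA uA.
exists #|I|, (fun i => A (enum_val i)), (fun i => x (enum_val i)); split=> //.
apply/funext => s; have [i Ais] := cA s.
rewrite (uA _ _ Ais) (bigD1 (enum_rank i))//= enum_rankK indicE mem_set// scale1r.
rewrite big1 ?addr0// => j step_norm; rewrite indicE memNset ?scale0r// => Aj.
by move/eqP: step_norm; apply; rewrite -(tA _ _ _ Aj Ais) enum_valK.
Qed.

Lemma simple_comp (V W : normedModType K) (f : V -> W) (u : R -> V) :
  simple_function u -> simple_function (f \o u).
Proof.
move=> /simple_partition[I [A [x [mA cA tA uA]]]].
apply: (@simple_of_partition _ _ I A (f \o x)) => // i s /uA /=.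
by move=> ->.
Qed.

Lemma simple_comp2 (V W Y : normedModType K) (f : V -> W -> Y)
    (u : R -> V) (v : R -> W) :
  simple_function u -> simple_function v -> simple_function (fun s => f (u s) (v s)).
Proof.
move=> /simple_partition[I [A [x [mA cA tA uA]]]].
move=> /simple_partition[I' [B [y [mB cB tB vB]]]].
apply: (@simple_of_partition _ _ (I * I')%type
  (fun p => A p.1 `&` B p.2) (fun p => f (x p.1) (y p.2))).
- by move=> i; exact: measurableI.
- move=> s; have [i Ai] := cA s; have [j Bj] := cB s.
  by exists (i, j).
- by move=> [i i'] [j j'] s /= [a b] [c d]; rewrite (tA _ _ _ a c) (tB _ _ _ b d).
- by move=> [i i'] s /= [/uA -> /vB ->].
Qed.

Definition lipschitz_rnorm (V W : normedModType K) (f : V -> W) :=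
  exists C : R, forall x y, rnorm (f x - f y) <= C * rnorm (x - y).

Lemma smeas_simple (V : normedModType K) (u : R -> V) :
  simple_function u -> strongly_measurable u.
Proof. by move=> su; exists (fun=> u) => // s _; exact: cvg_cst. Qed.

Lemma smeas_lip (V W : normedModType K) (f : V -> W) (u : R -> V) :
  lipschitz_rnorm f -> strongly_measurable u -> strongly_measurable (f \o u).
Proof.
move=> [C hC] [w sw wu]; exists (fun n => f \o w n).
  by move=> n; exact: simple_comp.
move=> s Is; apply/cvg_rnormP => e e0.
have C1 : 0 < `|C| + 1 by rewrite ltr_wpDl.
have /cvg_rnormP /(_ (e / (`|C| + 1))) [|N hN] := wu s Is; first by rewrite divr_gt0.
exists N => n /hN h; apply: le_lt_trans (hC _ _) _.
rewrite ltr_pdivlMr// mulrC in h; apply: le_lt_trans h.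
by rewrite ler_wpM2r ?rnorm_ge0// (le_trans (ler_norm _))// lerDl.
Qed.

Lemma smeasD (V : normedModType K) (u v : R -> V) :
  strongly_measurable u -> strongly_measurable v ->
  strongly_measurable (fun s => u s + v s).
Proof.
move=> [w sw wu] [w' sw' wv]; exists (fun n s => w n s + w' n s).
  by move=> n; exact: (@simple_comp2 _ _ _ +%R).
by move=> s Is; apply: cvgD; [exact: wu|exact: wv].
Qed.

Lemma lipZ (V : normedModType K) (a : K) : lipschitz_rnorm (fun x : V => a *: x).
Proof. by exists (snorm a) => x y; rewrite -scalerBr rnormZ. Qed.

Lemma smeasZ (V : normedModType K) (a : K) (u : R -> V) :
  strongly_measurable u -> strongly_measurable (fun s => a *: u s).
Proof. exact/smeas_lip/lipZ. Qed.

Lemma smeas_tensor (V : normedModType K) (f : R -> K) (x : V) :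
  strongly_measurable (f : R -> K^o) -> strongly_measurable (tensor f x).
Proof.
move=> sf; apply: (@smeas_lip K^o V (fun a : K => a *: x)) sf.
by exists (rnorm x) => a b; rewrite -scalerBl rnormZ mulrC.
Qed.

(** The composition is a pointwise limit of real functions with finitely many
    measurable level sets. *)
Lemma smeas_real (V : normedModType K) (f : V -> R) (u : R -> V) :
  (exists C : R, forall x y, `|f x - f y| <= C * rnorm (x - y)) ->
  strongly_measurable u -> measurable_fun I01 (f \o u).
Proof.
move=> [C hC] [w sw wu].
apply: (@measurable_fun_cvg _ _ _ _ (fun n => f \o w n)).
  move=> n; have [I [A [x [mA cA tA uA]]]] := simple_partition (sw n).
  rewrite (_ : f \o w n = (fun s => \sum_(i <- enum I) \1_(A i) s * f (x i))).
    by apply: measurable_sum => i; apply: measurable_funM.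
  apply/funext => s /=; have [i Ai] := cA s.
  rewrite (uA _ _ Ai) big_enum/= (bigD1 i)//= indicE mem_set// mul1r.
  rewrite big1 ?addr0// => j step_norm; rewrite indicE memNset ?mul0r// => Aj.
  by move/eqP: step_norm; apply; exact: (tA _ _ _ Aj Ai).
move=> s Is; apply/cvgrPdist_lt => e e0.
have C1 : 0 < `|C| + 1 by rewrite ltr_wpDl.
have /cvg_rnormP /(_ (e / (`|C| + 1))) [|N hN] := wu s Is; first by rewrite divr_gt0.
near=> n; rewrite distrC; apply: le_lt_trans (hC _ _) _.
have h : rnorm (w n s - u s) < e / (`|C| + 1) by apply: hN; near: n; exists N.
rewrite ltr_pdivlMr// mulrC in h; apply: le_lt_trans h.
by rewrite ler_wpM2r ?rnorm_ge0// (le_trans (ler_norm _))// lerDl.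
Unshelve. all: by end_near. Qed.

Lemma smeas_rnorm (V : normedModType K) (u : R -> V) :
  strongly_measurable u -> measurable_fun I01 (fun s => rnorm (u s)).
Proof.
by apply: smeas_real; exists 1 => x y; rewrite mul1r rnorm_lip.
Qed.

Lemma smeas_ernorm (V : normedModType K) (u : R -> V) :
  strongly_measurable u -> measurable_fun I01 (fun s => (rnorm (u s))%:E).
Proof. move=> su.
have h := smeas_rnorm su.
exact/measurable_EFinP. Qed.

Lemma smeas_sre (u : R -> K) :
  strongly_measurable (u : R -> K^o) -> measurable_fun I01 (fun s => sre (u s)).
Proof.
apply: (@smeas_real K^o (fun a : K => sre a)); exists 1 => x y.
by rewrite mul1r -sreN -sreD sre_norm_le.
Qed.

Lemma smeas_sim (u : R -> K) :
  strongly_measurable (u : R -> K^o) -> measurable_fun I01 (fun s => sim (u s)).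
Proof.
apply: (@smeas_real K^o (fun a : K => sim a)); exists 1 => x y.
by rewrite mul1r -simN -simD sim_norm_le.
Qed.

End StrongMeasurability.

(** * Bochner integrable functions and bounded operators *)

Section L1Theory.
Variables (R : realType) (k : scalar_kind).
Local Notation K := (scalar_field R k).
Local Notation mu := (@lebesgue_measure R).
Local Notation I01 := (@unit_itv R).

Section Norm.
Variable V : normedModType K.
Implicit Types u v w : R -> V.

Lemma L1norm_ge0 u : (0 <= L1norm u)%E.
Proof. by apply: integral_ge0 => s _; rewrite lee_fin rnorm_ge0. Qed.

Lemma ae_eq_fun_trans u v w : ae_eq_fun u v -> ae_eq_fun v w -> ae_eq_fun u w.
Proof. by apply: ae_imp2 => s h h' Is; rewrite h// h'. Qed.

Lemma ae_eq_funZ (a : K) u u' : ae_eq_fun u u' ->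
  ae_eq_fun (fun s => a *: u s) (fun s => a *: u' s).
Proof. by apply: ae_imp => s h Is; rewrite h. Qed.

Lemma L1norm_ae u v : strongly_measurable u -> strongly_measurable v ->
  ae_eq_fun u v -> L1norm u = L1norm v.
Proof.
move=> su sv uv; apply: ge0_ae_eq_integral => //.
- exact: smeas_ernorm.
- exact: smeas_ernorm.
- by move=> s _; rewrite lee_fin rnorm_ge0.
- by move=> s _; rewrite lee_fin rnorm_ge0.
- by apply: ae_imp uv => s h Is; rewrite h.
Qed.

Lemma L1normD u v : strongly_measurable u -> strongly_measurable v ->
  (L1norm (fun s => u s + v s)%R <= L1norm u + L1norm v)%E.
Proof.
move=> su sv; rewrite /L1norm -ge0_integralD//; last 4 first.
- by move=> s _; rewrite lee_fin rnorm_ge0.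
- exact: smeas_ernorm.
- by move=> s _; rewrite lee_fin rnorm_ge0.
- exact: smeas_ernorm.
apply: ge0_le_integral => //.
- by move=> s _; rewrite lee_fin rnorm_ge0.
- by apply: smeas_ernorm; exact: smeasD.
- by apply: emeasurable_funD; exact: smeas_ernorm.
- by move=> s _; rewrite -EFinD lee_fin rnormD.
Qed.

Lemma L1normZ (a : K) u : strongly_measurable u ->
  (L1norm (fun s => a *: u s)%R = (snorm a)%:E * L1norm u)%E.
Proof.
move=> su; rewrite /L1norm -ge0_integralZl_EFin ?snorm_ge0//.
- by apply: eq_integral => s _; rewrite rnormZ EFinM.
- by move=> s _; rewrite lee_fin rnorm_ge0.
- exact: smeas_ernorm.
Qed.

Lemma smeas_cst (x : V) : strongly_measurable (fun _ : R => x).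
Proof.
apply: smeas_simple; exists 1%N, (fun=> setT), (fun=> x); split=> //.
by apply/funext => s; rewrite big_ord1 indicT scale1r.
Qed.

Lemma L1norm0 : L1norm (fun _ : R => 0 : V) = 0%E.
Proof.
rewrite /L1norm (eq_integral (cst 0%E)) ?integral0// => s _.
by rewrite rnorm0.
Qed.

Lemma in_L1_0 : in_L1 (fun _ : R => 0 : V).
Proof. by split; [exact: smeas_cst|rewrite L1norm0]. Qed.

Lemma in_L1D u v : in_L1 u -> in_L1 v -> in_L1 (fun s => u s + v s).
Proof.
move=> [su u1] [sv v1]; split; first exact: smeasD.
by apply: le_lt_trans (L1normD su sv) _; rewrite lte_add_pinfty.
Qed.

Lemma in_L1Z (a : K) u : in_L1 u -> in_L1 (fun s => a *: u s).
Proof.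
move=> [su u1]; split; first exact: smeasZ.
by rewrite L1normZ// lte_mul_pinfty// lee_fin snorm_ge0.
Qed.

Lemma in_L1N u : in_L1 u -> in_L1 (fun s => - u s).
Proof.
by move=> /(in_L1Z (-1)); congr in_L1; apply/funext => s; rewrite scaleN1r.
Qed.

Lemma in_L1B u v : in_L1 u -> in_L1 v -> in_L1 (fun s => u s - v s).
Proof. by move=> u1 /in_L1N; exact: in_L1D. Qed.

Lemma in_L1_sum (I : Type) (r : seq I) (u : I -> R -> V) :
  (forall i, in_L1 (u i)) -> in_L1 (fun s => \sum_(i <- r) u i s).
Proof.
move=> hu; elim: r => [|i r IH].
  by under eq_fun do rewrite big_nil; exact: in_L1_0.
by under eq_fun do rewrite big_cons; exact: in_L1D.
Qed.

Lemma L1norm_fin u : in_L1 u -> L1norm u \is a fin_num.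
Proof. by move=> [_ h]; rewrite ge0_fin_numE// L1norm_ge0. Qed.

End Norm.

Lemma L1norm_tensor (V : normedModType K) (f : R -> K) (x : V) :
  strongly_measurable (f : R -> K^o) ->
  (L1norm (tensor f x) = L1norm (f : R -> K^o) * (rnorm x)%:E)%E.
Proof.
move=> sf; rewrite /L1norm muleC -ge0_integralZl_EFin ?rnorm_ge0//.
- by apply: eq_integral => s _; rewrite rnormZ EFinM muleC.
- by move=> s _; rewrite lee_fin rnorm_ge0.
- exact: (@smeas_ernorm _ _ K^o).
Qed.

Lemma in_L1_tensor (V : normedModType K) (f : R -> K) (x : V) :
  in_L1 (f : R -> K^o) -> in_L1 (tensor f x).
Proof.
move=> [sf f1]; split; first exact: smeas_tensor.
by rewrite L1norm_tensor// muleC lte_mul_pinfty// lee_fin rnorm_ge0.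
Qed.

Section Operators.
Variables V W : normedModType K.
Variable T : (R -> V) -> (R -> W).
Hypothesis bT : bounded_L1op T.

Lemma L1op0 : ae_eq_fun (T (fun=> 0)) (fun=> 0).
Proof.
have := L1op_linear bT 1 (@in_L1_0 V) (@in_L1_0 V).
rewrite (_ : (fun s => _) = (fun=> 0)); last by apply/funext => s; rewrite scaler0 addr0.
apply: ae_imp => s h Is; have := h Is.
by rewrite scale1r -[X in X = _]addr0 => /addrI ->.
Qed.

Lemma L1opZ (a : K) u : in_L1 u -> ae_eq_fun (T (fun s => a *: u s)) (fun s => a *: T u s).
Proof.
move=> u1; have := L1op_linear bT a u1 (@in_L1_0 V).
rewrite (_ : (fun s => _) = (fun s => a *: u s)); last by apply/funext => s; rewrite addr0.
by have := L1op0; apply: ae_imp2 => s h h' Is; rewrite h'// h// addr0.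
Qed.

Lemma L1opD u v : in_L1 u -> in_L1 v ->
  ae_eq_fun (T (fun s => u s + v s)) (fun s => T u s + T v s).
Proof.
move=> u1 v1; have := L1op_linear bT 1 u1 v1.
rewrite (_ : (fun s => _) = (fun s => u s + v s)); last by apply/funext => s; rewrite scale1r.
by apply: ae_imp => s h Is; rewrite h// scale1r.
Qed.

Lemma L1op_sum (I : Type) (r : seq I) (u : I -> R -> V) :
  (forall i, in_L1 (u i)) ->
  ae_eq_fun (T (fun s => \sum_(i <- r) u i s)) (fun s => \sum_(i <- r) T (u i) s).
Proof.
move=> hu; elim: r => [|i r IH].
  have -> : (fun s => \sum_(i <- [::]) u i s) = fun=> 0.
    by apply/funext => s; rewrite big_nil.
  by apply: ae_imp L1op0 => s h Is; rewrite big_nil h.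
have -> : (fun s => \sum_(j <- i :: r) u j s) = fun s => u i s + \sum_(j <- r) u j s.
  by apply/funext => s; rewrite big_cons.
have := L1opD (hu i) (in_L1_sum r hu).
by move: IH; apply: ae_imp2 => s h h' Is; rewrite h'// big_cons h.
Qed.

(** Scaling to norm one, which needs the homogeneity of [T] only almost
    everywhere; boundedness takes care of functions of norm zero. *)
Lemma L1opnorm_bound (c : R) (u : R -> V) :
  (L1opnorm T <= c%:E)%E -> in_L1 u -> (L1norm (T u) <= c%:E * L1norm u)%E.
Proof.
move=> hc u1; have [C hC] := L1op_bounded bT.
have ufin := L1norm_fin u1; set r := fine (L1norm u).
have rE : L1norm u = r%:E by rewrite fineK.
have r0 : 0 <= r by rewrite fine_ge0// L1norm_ge0.
have [r_eq0|rn0] := eqVneq r 0.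
  by have := hC _ u1; rewrite rE r_eq0 !mule0.
have rgt0 : 0 < r by rewrite lt_neqAle eq_sym rn0.
pose v s := of_real k r^-1 *: u s.
have v1 : in_L1 v by exact: in_L1Z.
have Nv : L1norm v = 1%E.
  rewrite /v L1normZ; last exact: u1.1.
  by rewrite rE snorm_of_real gtr0_norm ?invr_gt0// -EFinM mulVf.
have : (L1norm (T v) <= c%:E)%E.
  by apply: le_trans hc; apply: ereal_sup_ubound; exists v => //; split => //; rewrite Nv.
rewrite (L1norm_ae (L1op_in_L1 bT v1).1 _ (L1opZ _ u1)); last first.
  by apply: smeasZ; exact: (L1op_in_L1 bT u1).1.
rewrite L1normZ; last exact: (L1op_in_L1 bT u1).1.
rewrite snorm_of_real gtr0_norm ?invr_gt0// => h.
by rewrite rE -lee_pdivrMr// muleC.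
Qed.

End Operators.

Lemma L1op_sub_bounded (V W : normedModType K) (T S : (R -> V) -> (R -> W)) :
  bounded_L1op T -> bounded_L1op S -> bounded_L1op (L1op_sub T S).
Proof.
move=> bT bS; split.
- by move=> u u1; apply: in_L1B; [exact: (L1op_in_L1 bT)|exact: (L1op_in_L1 bS)].
- move=> a u v u1 v1; have := L1op_linear bT a u1 v1; have := L1op_linear bS a u1 v1.
  apply: ae_imp2 => s h h' Is; rewrite /L1op_sub h// h'// scalerBr.
  by rewrite opprD addrACA.
- have [C hC] := L1op_bounded bT; have [C' hC'] := L1op_bounded bS.
  exists (C + C') => u u1; rewrite /L1op_sub.
  have Tu := (L1op_in_L1 bT u1).1; have Su := (L1op_in_L1 bS u1).1.
  rewrite -[X in (X <= _)%E](_ : L1norm (fun s => T u s + (-1) *: S u s) = _); last first.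
    by congr L1norm; apply/funext => s; rewrite scaleN1r.
  apply: le_trans (L1normD Tu (smeasZ _ Su)) _.
  rewrite L1normZ// -of_real1 -of_realN snorm_of_real normrN1 mul1e.
  have := leeD (hC _ u1) (hC' _ u1).
  by rewrite -(fineK (L1norm_fin u1)) -!EFinM -EFinD -mulrDl.
Qed.

End L1Theory.

(** * Dyadic step functions *)

Section DyadicSteps.
Variable R : realType.
Local Notation mu := (@lebesgue_measure R).
Local Notation I01 := (@unit_itv R).

Definition dyadic_pos (m : nat) (s : R) : nat := Num.truncn (s * 2 ^+ m).

Lemma exp2_gt0 (m : nat) : 0 < 2 ^+ m :> R. Proof. by rewrite exprn_gt0. Qed.
Hint Resolve exp2_gt0 : core.

Lemma mul_exp2_ge0 (m : nat) (s : R) : 0 <= s -> 0 <= s * 2 ^+ m.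
Proof. by move=> s0; rewrite mulr_ge0// ltW. Qed.

Lemma unit_itvP (s : R) : I01 s <-> 0 <= s < 1.
Proof. by rewrite /unit_itv /= in_itv. Qed.

Lemma dyadic_itvP (m i : nat) (s : R) : 0 <= s ->
  @Defs.dyadic_itv R m i s <-> dyadic_pos m s = i.
Proof.
move=> s0; rewrite /Defs.dyadic_itv /= in_itv /= ler_pdivrMr// ltr_pdivlMr//.
rewrite -(@truncn_eq _ (s * 2 ^+ m) i) ?mul_exp2_ge0//.
by split=> [/eqP|/eqP].
Qed.

Lemma dyadic_itv_ge0 (m i : nat) (s : R) : @Defs.dyadic_itv R m i s -> 0 <= s.
Proof.
rewrite /Defs.dyadic_itv /= in_itv /= => /andP[+ _]; apply: le_trans.
by rewrite divr_ge0// ltW.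
Qed.

Lemma dyadic_pos_lt (m : nat) (s : R) : I01 s -> (dyadic_pos m s < 2 ^ m)%N.
Proof.
move=> /unit_itvP/andP[s0 s1].
by rewrite truncn_lt_nat ?mul_exp2_ge0// natrX -[ltRHS]mul1r ltr_pM2r.
Qed.

Lemma dyadic_posS (m : nat) (s : R) : 0 <= s ->
  dyadic_pos m s = (dyadic_pos m.+1 s)./2.
Proof.
move=> s0; apply/eqP; rewrite /dyadic_pos truncn_eq ?mul_exp2_ge0//.
set t := s * 2 ^+ m; have -> : s * 2 ^+ m.+1 = 2 * t by rewrite exprS mulrCA.
have t0 : 0 <= 2 * t by rewrite mulr_ge0// mul_exp2_ge0.
have /andP[h1 h2] := truncn_itv t0; move: h1 h2; set j := Num.truncn _ => h1 h2.
have e : j%:R = (odd j)%:R + 2 * (j./2)%:R :> R.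
  by rewrite -{1}(odd_double_half j) natrD -mul2n natrM.
have o1 : (odd j)%:R <= 1 :> R by case: (odd j).
have o0 : 0 <= (odd j)%:R :> R by case: (odd j).
rewrite -[j.+1%:R]natr1 in h2; rewrite -[(_./2).+1%:R]natr1.
by apply/andP; split; lra.
Qed.

Lemma dyadic_itv_unit (m i : nat) (s : R) : (i < 2 ^ m)%N ->
  @Defs.dyadic_itv R m i s -> I01 s.
Proof.
move=> im si; have s0 := dyadic_itv_ge0 si; apply/unit_itvP; rewrite s0 /=.
move: si; rewrite /Defs.dyadic_itv /= in_itv /= => /andP[_ /lt_le_trans]; apply.
by rewrite ler_pdivrMr// mul1r -natrX ler_nat.
Qed.

Lemma measurable_dyadic_itv (m i : nat) : measurable (@Defs.dyadic_itv R m i).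
Proof. exact: measurable_itv. Qed.

Lemma lebesgue_dyadic_itv (m i : nat) : mu (@Defs.dyadic_itv R m i) = ((2 ^+ m)^-1)%:E.
Proof.
rewrite /Defs.dyadic_itv lebesgue_measure_itv /= lte_fin ltr_pM2r ?invr_gt0//.
by rewrite ltr_nat ltnSn -EFinB -mulrBl -natr1 addrAC subrr add0r mul1r.
Qed.

Section Scalars.
Variable k : scalar_kind.
Local Notation K := (scalar_field R k).

(** A step function of level [m] is encoded by its values [c i] on the intervals
    [i / 2 ^ m, (i + 1) / 2 ^ m); coefficients with [2 ^ m <= i] are junk, and
    the function vanishes outside [0, 1). Refinement is composition of [c] with
    halving of indices. *)
Definition step (m : nat) (c : nat -> K) (s : R) : K := \1_I01 s * c (dyadic_pos m s).

Lemma step_unit m c s : I01 s -> step m c s = c (dyadic_pos m s).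
Proof. by move=> Is; rewrite /step indicE mem_set// mul1r. Qed.

Lemma step_out m c s : ~ I01 s -> step m c s = 0.
Proof. by move=> Is; rewrite /step indicE memNset// mul0r. Qed.

Lemma eq_step m c c' : (forall i, (i < 2 ^ m)%N -> c i = c' i) -> step m c = step m c'.
Proof.
move=> h; apply/funext => s; have [Is|Is] := pselect (I01 s).
  by rewrite !step_unit// h// dyadic_pos_lt.
by rewrite !step_out.
Qed.

Lemma stepS m c : step m c = step m.+1 (fun i => c i./2).
Proof.
apply/funext => s; have [Is|Is] := pselect (I01 s).
  by rewrite !step_unit// dyadic_posS//; case/unit_itvP/andP: Is.
by rewrite !step_out.
Qed.

Lemma step_refine m c m' : (m <= m')%N -> exists c', step m c = step m' c'.
Proof.
move=> /subnK <-; elim: (m' - m)%N => [|d [c' ->]]; first by exists c.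
by exists (fun i => c' i./2); rewrite addSn stepS.
Qed.

Lemma step_lin m (a : K) c c' :
  (fun s => a * step m c s + step m c' s) = step m (fun i => a * c i + c' i).
Proof. by apply/funext => s; rewrite /step; ring. Qed.

Lemma step_indic m i : (i < 2 ^ m)%N ->
  \1_(@Defs.dyadic_itv R m i) = step m (fun j => (j == i)%:R).
Proof.
move=> im; apply/funext => s; have [Is|Is] := pselect (I01 s).
  have s0 : 0 <= s by case/unit_itvP/andP: Is.
  rewrite step_unit// indicE; suff -> : (s \in @Defs.dyadic_itv R m i) = (dyadic_pos m s == i) by [].
  apply/idP/eqP.
    by rewrite inE => /(dyadic_itvP _ _ s0).
  by move=> h; rewrite inE; apply/(dyadic_itvP _ _ s0).
by rewrite step_out// indicE memNset// => /(dyadic_itv_unit im).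
Qed.

Lemma step_sum m c :
  step m c = (fun s => \sum_(i < 2 ^ m) c i * \1_(@Defs.dyadic_itv R m i) s).
Proof.
apply/funext => s; have [Is|Is] := pselect (I01 s).
  rewrite step_unit// (bigD1 (Ordinal (dyadic_pos_lt m Is)))//= step_indic ?dyadic_pos_lt//.
  rewrite step_unit// eqxx mulr1 big1 ?addr0// => j step_norm.
  rewrite step_indic// step_unit// (negbTE (_ : dyadic_pos m s != j)) ?mulr0//.
  by apply: contra_neq step_norm => h; apply: val_inj.
by rewrite step_out// big1// => j _; rewrite step_indic// step_out// mulr0.
Qed.

Lemma dyadic_step_step m c : dyadic_step (step m c).
Proof.
exists (2 ^ m)%N, (fun i => c i), (fun i => Tagged (fun j => 'I_(2 ^ j)) i).
by rewrite step_sum.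
Qed.

Lemma dyadic_stepP (f : R -> K) : dyadic_step f -> exists m c, f = step m c.
Proof.
move=> [n [c [Q ->]]]; elim: n c Q => [|n IH] c Q.
  exists 0%N, (fun=> 0); apply/funext => s; rewrite big_ord0 /step mulr0//.
have [m [c' e]] := IH (fun i => c (lift ord0 i)) (fun i => Q (lift ord0 i)).
have [c1 e1] := step_refine (fun j => (j == tagged (Q ord0))%:R) (leq_maxl (tag (Q ord0)) m).
have [c2 e2] := step_refine c' (leq_maxr (tag (Q ord0)) m).
exists (maxn (tag (Q ord0)) m), (fun i => c ord0 * c1 i + c2 i).
rewrite -step_lin -e1 -e2 -e; apply/funext => s.
by rewrite big_ord_recl -step_indic.
Qed.

Lemma haar_root : haar k None = step 0 (fun=> 1).
Proof.
apply/funext => s; rewrite /haar; have [Is|Is] := pselect (I01 s).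
  by rewrite step_unit// indicE mem_set.
by rewrite step_out// indicE memNset.
Qed.

Lemma haar_step (Q : dyadic_index) :
  haar k (Some Q) = step (tag Q).+1
    (fun j => (j == (tagged Q).*2)%:R - (j == (tagged Q).*2.+1)%:R).
Proof.
have h : ((tagged Q).*2.+1 < 2 ^ (tag Q).+1)%N.
  by rewrite expnS mul2n -doubleS leq_double.
apply/funext => s; rewrite /haar mul2n !step_indic//; last exact: ltnW.
by rewrite /step; ring.
Qed.

End Scalars.
End DyadicSteps.
#[global] Hint Resolve exp2_gt0 : core.

(** * Integrals and distributions of step functions *)

Section StepIntegral.
Variable R : realType.
Local Notation mu := (@lebesgue_measure R).
Local Notation I01 := (@unit_itv R).

Lemma integrable_indic_unit (A : set R) : measurable A ->
  mu.-integrable I01 (EFin \o \1_A).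
Proof.
move=> mA; apply: measurable_bounded_integrable => //.
- by rewrite [X in (X < _)%E](lebesgue_unit R) ltry.
- exists 1; split; first exact: num_real.
  move=> x x1 s _ /=; rewrite indicE; case: (_ \in _); rewrite ?normr1 ?normr0 ltW//.
  by rewrite (lt_trans ltr01).
Qed.

Lemma Rintegral_sum_indic (I : Type) (r : seq I) (A : I -> set R) (c : I -> R) :
  (forall i, measurable (A i)) ->
  mu.-integrable I01 (EFin \o (fun s => \sum_(i <- r) c i * \1_(A i) s)) /\
  Rintegral mu I01 (fun s => \sum_(i <- r) c i * \1_(A i) s) =
  \sum_(i <- r) c i * fine (mu (A i `&` I01)).
Proof.
move=> mA; elim: r => [|i r [IH1 IH2]].
  under [X in EFin \o X]eq_fun do rewrite big_nil.
  under eq_Rintegral do rewrite big_nil.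
  rewrite big_nil Rintegral_cst// mul0r; split=> //.
  exact: integrable0.
under [X in EFin \o X]eq_fun do rewrite big_cons.
under eq_Rintegral do rewrite big_cons.
have i1 : mu.-integrable I01 (EFin \o (fun s => c i * \1_(A i) s)).
  by apply: eq_integrable (integrableZl _ (c i) (integrable_indic_unit (mA i))).
split; first by apply: eq_integrable (integrableD _ i1 IH1).
rewrite RintegralD; [|exact: measurable_unit|exact: i1|exact: IH1].
rewrite IH2 big_cons RintegralZl//; last exact: integrable_indic_unit.
by rewrite {1}/Rintegral integral_indic; [|exact: measurable_unit|exact: mA].
Qed.

Lemma Rintegral_step (m : nat) (r : nat -> R) :
  Rintegral mu I01 (@step R RealScalars m r) = (2 ^+ m)^-1 * \sum_(i < 2 ^ m) r i.
Proof.
rewrite step_sum (Rintegral_sum_indic _ _ (fun i : 'I_(2 ^ m) => @measurable_dyadic_itv R m i)).2.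
rewrite mulr_sumr; apply: eq_bigr => i _; rewrite mulrC; congr (_ * _).
rewrite (_ : _ `&` _ = @Defs.dyadic_itv R m i) ?lebesgue_dyadic_itv//.
by apply/setIidPl => s; apply: dyadic_itv_unit.
Qed.

Section Scalars.
Variable k : scalar_kind.
Local Notation K := (scalar_field R k).

Lemma sre_sum (I : Type) (r : seq I) (F : I -> K) :
  sre (\sum_(i <- r) F i) = \sum_(i <- r) sre (F i).
Proof. by elim/big_rec2: _ => [|i a b _ <-]; [case: k|rewrite sreD]. Qed.

Lemma sim_sum (I : Type) (r : seq I) (F : I -> K) :
  sim (\sum_(i <- r) F i) = \sum_(i <- r) sim (F i).
Proof. by elim/big_rec2: _ => [|i a b _ <-]; [rewrite /sim; case: k|rewrite simD]. Qed.

Lemma scalar_integral_step (m : nat) (c : nat -> K) :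
  scalar_integral (step m c) = of_real k (2 ^+ m)^-1 * \sum_(i < 2 ^ m) c i.
Proof.
apply: scalar_ext.
  rewrite sre_scalar_integral sreZ sre_sum -(Rintegral_step m (fun i => sre (c i))).
  by apply: eq_Rintegral => s _; rewrite /step indicK sreZ.
rewrite sim_scalar_integral simZ sim_sum -(Rintegral_step m (fun i => sim (c i))).
by apply: eq_Rintegral => s _; rewrite /step indicK simZ.
Qed.

Lemma lebesgue_step_preimage (m : nat) (c : nat -> K) (A : set R) :
  mu (I01 `&` [set s | A (snorm (step m c s))]) =
  (\sum_(i < 2 ^ m | `[< A (snorm (c i)) >]) (2 ^+ m)^-1%:E)%E.
Proof.
rewrite (_ : _ `&` _ = \big[setU/set0]_(i < 2 ^ m | `[< A (snorm (c i)) >])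
    @Defs.dyadic_itv R m i).
  rewrite measure_bigsetU_ord.
  - by apply: eq_bigr => i _; exact: lebesgue_dyadic_itv.
  - by move=> i; exact: measurable_dyadic_itv.
  - apply/trivIsetP => i j _ _ ij; apply/eqP; apply: contraNT ij => /set0P[s [si sj]].
    have s0 := dyadic_itv_ge0 si.
    apply/eqP; apply: val_inj => /=.
    by move: si sj => /(dyadic_itvP _ _ s0) <- /(dyadic_itvP _ _ s0).
rewrite -(bigcup_pred (fun i : 'I_(2 ^ m) => `[< A (snorm (c i)) >]) (fun i => @Defs.dyadic_itv R m i)).
apply/seteqP; split=> s /=.
  move=> [Is]; rewrite step_unit// => As.
  exists (Ordinal (dyadic_pos_lt m Is)) => /=; first exact/asboolP.
  by apply/dyadic_itvP => //; case/unit_itvP/andP: Is.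
move=> [i /= /asboolP Ai si]; have Is := dyadic_itv_unit (ltn_ord i) si.
split=> //; rewrite step_unit//.
by move: si => /[dup] /dyadic_itv_ge0 s0 /(dyadic_itvP _ _ s0) ->.
Qed.

Lemma step_same_distribution (m : nat) (c c' : nat -> K) (h : 'I_(2 ^ m) -> 'I_(2 ^ m)) :
  injective h -> (forall i : 'I_(2 ^ m), snorm (c' i) = snorm (c (h i))) ->
  same_abs_distribution (step m c') (step m c).
Proof.
move=> hinj cc' A _; rewrite !lebesgue_step_preimage.
by rewrite [RHS](reindex_inj hinj); apply: eq_bigl => i; rewrite cc'.
Qed.

End Scalars.
End StepIntegral.

(** * Averages and the norm of step functions *)

Section Averages.
Variable F : numFieldType.
Implicit Types c : nat -> F.

Definition avg c (i : nat) : F := (c i.*2 + c i.*2.+1) / 2.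

Fixpoint avgn (d : nat) c : nat -> F := if d is d'.+1 then avgn d' (avg c) else c.

Lemma avg_ext c c' : c =1 c' -> avg c =1 avg c'.
Proof. by move=> h i; rewrite /avg !h. Qed.

Lemma avgn_ext d c c' : c =1 c' -> avgn d c =1 avgn d c'.
Proof. by elim: d c c' => //= d IH c c' h; apply/IH/avg_ext. Qed.

Lemma avgnSl d c : avgn d.+1 c =1 avg (avgn d c).
Proof. by elim: d c => //= d IH c i; rewrite -/(avgn d.+1 (avg c)) IH. Qed.

Lemma avgn_add d e c : avgn (d + e) c =1 avgn d (avgn e c).
Proof. by elim: e c => [|e IH] c i; rewrite ?addn0// addnS /= IH. Qed.

Lemma sum_double (n : nat) c :
  \sum_(i < n.*2) c i = \sum_(i < n) (c i.*2 + c i.*2.+1).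
Proof.
elim: n => [|n IH]; first by rewrite !big_ord0.
by rewrite doubleS !big_ord_recr /= IH addrA.
Qed.

Lemma avgn_mean d c : avgn d c 0%N = (2 ^+ d)^-1 * \sum_(i < 2 ^ d) c i.
Proof.
elim: d c => [|d IH] c; first by rewrite expn0 big_ord1 expr0 invr1 mul1r.
rewrite /= IH expnS mul2n sum_double exprS invfM -mulrA [RHS]mulrCA; congr (_ * _).
by rewrite mulr_sumr; apply: eq_bigr => i _; rewrite /avg mulrC.
Qed.

(** Averages are linear over coefficients that are constant on the intervals
    averaged out, as [iter d half t] is the ancestor of [t] by [d] levels. *)
Lemma avgn_mull d (e : nat -> F) c :
  avgn d (fun t => e (iter d half t) * c t) =1 (fun i => e i * avgn d c i).
Proof.
elim: d c => [//|d IH] c i; rewrite /= -IH; apply: avgn_ext => j.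
rewrite /avg -!iterS !iterSr doubleK /= uphalf_double.
by rewrite -mulrDr mulrA.
Qed.

Lemma avgn0 d : avgn d (fun=> 0) =1 (fun=> 0).
Proof.
elim: d => //= d IH i; rewrite -[RHS](IH i); apply: avgn_ext => j.
by rewrite /avg addr0 mul0r.
Qed.

Lemma avgn_le d (c c' : nat -> F) : (forall i, c i <= c' i) ->
  forall i, avgn d c i <= avgn d c' i.
Proof.
elim: d c c' => //= d IH c c' h i; apply: IH => j.
by rewrite /avg ler_wpM2r ?invr_ge0// lerD.
Qed.

End Averages.

Section HaarSystemSpace.
Variables (R : realType) (k : scalar_kind).
Local Notation K := (scalar_field R k).
Variables (X : completeNormedModType K) (J : (R -> K) -> X).
Hypothesis hX : haar_system_space J.

Definition Jstep (m : nat) (c : nat -> K) : X := J (step m c).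
Definition step_norm (m : nat) (c : nat -> K) : R := rnorm (Jstep m c).

Lemma eq_Jstep m c c' : (forall i, (i < 2 ^ m)%N -> c i = c' i) -> Jstep m c = Jstep m c'.
Proof. by move=> h; rewrite /Jstep (eq_step h). Qed.

Lemma eq_step_norm m c c' : (forall i, (i < 2 ^ m)%N -> c i = c' i) -> step_norm m c = step_norm m c'.
Proof. by move=> h; rewrite /step_norm (eq_Jstep h). Qed.

Lemma JstepS m c : Jstep m c = Jstep m.+1 (fun i => c i./2).
Proof. by rewrite /Jstep stepS. Qed.

Lemma Jstep_refine m d c : Jstep m c = Jstep (m + d) (fun i => c (iter d half i)).
Proof.
elim: d c => [|d IH] c; first by rewrite addn0.
rewrite IH JstepS addnS; apply: eq_Jstep => i _.
by rewrite -iterSr.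
Qed.

Lemma Jstep_lin m a c c' :
  Jstep m (fun i => a * c i + c' i) = a *: Jstep m c + Jstep m c'.
Proof.
rewrite /Jstep -step_lin (hss_linear hX)//; exact: dyadic_step_step.
Qed.

Lemma Jstep0 m : Jstep m (fun=> 0) = 0.
Proof.
have := Jstep_lin m 1 (fun=> 0) (fun=> 0).
rewrite (@eq_Jstep m _ (fun=> 0)); last by move=> i _; rewrite mulr0 addr0.
by rewrite scale1r -[X in X = _]addr0 => /addrI ->.
Qed.

Lemma JstepZ m a c : Jstep m (fun i => a * c i) = a *: Jstep m c.
Proof.
rewrite -[RHS]addr0 -(Jstep0 m) -Jstep_lin; apply: eq_Jstep => i _.
by rewrite addr0.
Qed.

Lemma JstepD m c c' : Jstep m (fun i => c i + c' i) = Jstep m c + Jstep m c'.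
Proof.
rewrite -[Jstep m c]scale1r -Jstep_lin; apply: eq_Jstep => i _.
by rewrite mul1r.
Qed.

Lemma Jstep_sum m (I : Type) (r : seq I) (P : pred I) (c : I -> nat -> K) :
  Jstep m (fun i => \sum_(t <- r | P t) c t i) = \sum_(t <- r | P t) Jstep m (c t).
Proof.
elim: r => [|t r IH].
  by rewrite big_nil -(Jstep0 m); apply: eq_Jstep => i _; rewrite big_nil.
rewrite big_cons -IH; case: ifP => Pt.
  by rewrite -JstepD; apply: eq_Jstep => i _; rewrite big_cons Pt.
by apply: eq_Jstep => i _; rewrite big_cons Pt.
Qed.

Lemma step_norm_ge0 m c : 0 <= step_norm m c. Proof. exact: rnorm_ge0. Qed.

Lemma step_norm_dist m (c c' : nat -> K) (h : 'I_(2 ^ m) -> 'I_(2 ^ m)) :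
  injective h -> (forall i : 'I_(2 ^ m), snorm (c' i) = snorm (c (h i))) ->
  step_norm m c' = step_norm m c.
Proof.
move=> hinj cc'; congr (sre _); apply: (hss_distribution hX).
- exact: dyadic_step_step.
- exact: dyadic_step_step.
- exact: step_same_distribution cc'.
Qed.

Lemma step_norm_abs m (c c' : nat -> K) :
  (forall i, (i < 2 ^ m)%N -> snorm (c' i) = snorm (c i)) -> step_norm m c' = step_norm m c.
Proof. by move=> h; apply: (@step_norm_dist _ _ _ id) => // i; exact: h. Qed.

Lemma step_normZ m a c : step_norm m (fun i => a * c i) = snorm a * step_norm m c.
Proof. by rewrite /step_norm JstepZ rnormZ. Qed.

Lemma step_normD m c c' : step_norm m (fun i => c i + c' i) <= step_norm m c + step_norm m c'.
Proof. by rewrite /step_norm JstepD rnormD. Qed.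

Lemma snorm_half : snorm (2^-1 : K) = 2^-1.
Proof.
by rewrite snormV -(of_real_nat R k 2) snorm_of_real normr_nat.
Qed.

Lemma step_norm_mean2 m c c' : step_norm m c' = step_norm m c ->
  step_norm m (fun i => (c i + c' i) / 2) <= step_norm m c.
Proof.
move=> e; rewrite (@eq_step_norm _ _ (fun i => 2^-1 * (c i + c' i))); last by move=> i _; rewrite mulrC.
rewrite step_normZ snorm_half; have := step_normD m c c'; rewrite e; lra.
Qed.

Definition sibling (t : nat) : nat := if odd t then t.-1 else t.+1.

Lemma siblingK : involutive sibling.
Proof.
move=> t; rewrite /sibling; case: (boolP (odd t)) => o.
  have t0 : (0 < t)%N by case: t o.
  by rewrite -(prednK t0) /= in o *; rewrite (negbTE o).
by rewrite /= o.
Qed.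

Lemma sibling_half t : (sibling t)./2 = t./2.
Proof.
rewrite /sibling; case: (boolP (odd t)) => o.
  by case: t o => //= t o; rewrite uphalf_half (negbTE o).
by rewrite /= uphalf_half (negbTE o).
Qed.

Lemma sibling_lt m t : (t < 2 ^ m.+1)%N -> (sibling t < 2 ^ m.+1)%N.
Proof.
move=> h; have e u : (u < 2 ^ m.+1)%N = (u./2 < 2 ^ m)%N.
  by rewrite expnS mul2n ltn_half_double.
by rewrite e sibling_half -e.
Qed.

Lemma double_or_doubleS t : t = (t./2).*2 \/ t = (t./2).*2.+1.
Proof.
by rewrite -{1 3}(odd_double_half t); case: (odd t); [right|left].
Qed.

Lemma avg_half (c : nat -> K) t : avg c t./2 = (c t + c (sibling t)) / 2.
Proof.
rewrite /avg /sibling; have [e|e] := double_or_doubleS t; rewrite [in RHS]e /=.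
  by rewrite odd_double.
by rewrite odd_double /= addrC.
Qed.

(** Conditional expectation on a coarser dyadic level is the average of the
    identity and of the exchange of the two halves of every interval, and the
    latter preserves the distribution. *)
Lemma step_norm_avg m c : step_norm m (avg c) <= step_norm m.+1 c.
Proof.
rewrite /step_norm JstepS -/(step_norm _ _).
rewrite (@eq_step_norm _ _ (fun t => (c t + c (sibling t)) / 2)); last first.
  by move=> t _; exact: avg_half.
apply: step_norm_mean2.
pose h (i : 'I_(2 ^ m.+1)) := Ordinal (sibling_lt (ltn_ord i)).
apply: (@step_norm_dist _ _ _ h) => // i j /(congr1 val) /= ij.
by apply: val_inj; apply: (can_inj siblingK).
Qed.

Lemma step_norm_avgn m d c : step_norm m (avgn d c) <= step_norm (m + d) c.
Proof.
elim: d c => [|d IH] c; first by rewrite addn0.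
by rewrite /= (le_trans (IH _))// addnS step_norm_avg.
Qed.

(** Cutting a function to a union of intervals is the mean of the identity and
    of a change of signs. *)
Lemma step_norm_restrict m (P : nat -> bool) c : step_norm m (fun i => (P i)%:R * c i) <= step_norm m c.
Proof.
rewrite (@eq_step_norm _ _ (fun i => (c i + (-1) ^+ (~~ P i) * c i) / 2)); last first.
  move=> i _; case: (P i); rewrite /= ?expr0 ?expr1 ?mulN1r ?mul1r ?mul0r ?subrr ?mul0r//.
  by rewrite -mulr2n -[_ *+ 2]mulr_natr mulfK// pnatr_eq0.
apply: step_norm_mean2; apply: step_norm_abs => i _.
rewrite snormM; case: (P i); rewrite /= ?expr0 ?expr1 ?snorm1 ?mul1r//.
by rewrite -of_real1 -of_realN snorm_of_real normrN1 mul1r.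
Qed.

Lemma step_norm_one m : step_norm m (fun=> 1) = 1.
Proof.
have -> : step_norm m (fun=> 1) = step_norm 0 (fun=> 1) by rewrite /step_norm (@Jstep_refine 0 m).
rewrite /step_norm /Jstep -haar_root /haar /rnorm (hss_unit hX).
by rewrite -of_real1 of_realK.
Qed.

Lemma step_norm_level0 c : step_norm 0 c = snorm (c 0%N).
Proof.
rewrite (@eq_step_norm _ _ (fun i => c 0%N * 1)); last by case=> // _; rewrite mulr1.
by rewrite step_normZ step_norm_one mulr1.
Qed.

Definition absf (c : nat -> K) (i : nat) : R := snorm (c i).

Lemma of_real_avgn d (f : nat -> R) i :
  of_real k (avgn d f i) = avgn d (fun t => of_real k (f t)) i.
Proof.
elim: d f i => //= d IH f i; rewrite IH; apply: avgn_ext => j.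
by rewrite /avg of_realM of_realD of_realV of_real_nat.
Qed.

Lemma snorm_avgn d c i : snorm (avgn d c i) <= avgn d (absf c) i.
Proof.
elim: d c i => [//|d IH] c i /=; apply: le_trans (IH _ _) _.
apply: avgn_le => j; rewrite /absf /avg snormM snorm_half ler_wpM2r ?invr_ge0//.
exact: (@rnormD _ _ K^o).
Qed.

Definition point (i : nat) : nat -> K := fun t => (t == i)%:R.

(** The mean of [|f|] over a dyadic interval, times the norm of its indicator,
    is the norm of a conditional expectation of [|f|] cut to that interval. *)
Lemma local_mean j d c i : avgn d (absf c) i * step_norm j (point i) <= step_norm (j + d) c.
Proof.
pose c' t := (iter d half t == i)%:R * of_real k (absf c t).
have a0 : 0 <= avgn d (absf c) i.
  by rewrite -(avgn0 R d i); apply: avgn_le => t; rewrite /absf snorm_ge0.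
have -> : avgn d (absf c) i * step_norm j (point i) = step_norm j (avgn d c').
  rewrite -{1}[avgn d (absf c) i]ger0_norm// -(@snorm_of_real _ k) -step_normZ.
  apply: eq_step_norm => t _; rewrite (avgn_mull d (fun t => (t == i)%:R)) /point.
  case: (eqVneq t i) => [->|_]; last by rewrite mulr0 mul0r.
  by rewrite mulr1 mul1r of_real_avgn.
apply: le_trans (step_norm_avgn _ _ _) _.
apply: le_trans (step_norm_restrict _ (fun t => iter d half t == i) _) _.
rewrite (@step_norm_abs _ c)// => t _.
by rewrite snorm_of_real ger0_norm// /absf snorm_ge0.
Qed.

Lemma step_norm_mean d c : avgn d (absf c) 0%N <= step_norm d c.
Proof.
have := local_mean 0 d c 0; rewrite add0n step_norm_level0 /point eqxx snorm1 mulr1.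
exact.
Qed.

Lemma step_norm_point_le1 j i : step_norm j (point i) <= 1.
Proof.
rewrite -(step_norm_one j); apply: le_trans (step_norm_restrict j (fun t => t == i) (fun=> 1)).
by rewrite (@eq_step_norm _ _ (point i))// => t _; rewrite mulr1.
Qed.

Lemma step_norm_point_gt j i : (i < 2 ^ j)%N -> (2 ^+ j)^-1 <= step_norm j (point i).
Proof.
move=> ij; apply: le_trans (step_norm_mean _ _); rewrite avgn_mean.
rewrite (bigD1 (Ordinal ij))//= big1 => [|t ti].
  by rewrite addr0 /absf /point eqxx snorm1 mulr1.
rewrite /absf /point -[_ == _]/(t == Ordinal ij) (negbTE ti).
exact: snorm0.
Qed.

End HaarSystemSpace.

(** * Extension of functionals from step functions *)

Section Complete.
Variable R : realType.

Lemma real_cauchy_lim (r : nat -> R) :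
  (forall e, 0 < e -> exists N, forall m n, (N <= m)%N -> (N <= n)%N -> `|r m - r n| < e) ->
  exists l, forall e, 0 < e -> exists N, forall n, (N <= n)%N -> `|l - r n| < e.
Proof.
move=> hr; have : cauchy (r n @[n --> \oo]).
  apply: cauchy_exP => e e0; have [N hN] := hr e e0.
  by exists (r N); exists N => // n /= Nn; apply: hN.
move=> /cauchy_cvgP /cvg_ex [l /cvgrPdist_lt hl]; exists l => e e0.
by have [N _ hN] := hl e e0; exists N => n Nn; exact: hN.
Qed.

(** Cauchy sequences of scalars converge since their real and imaginary parts
    do. *)
Lemma scalar_cauchy_lim k (a : nat -> scalar_field R k) :
  (forall e, 0 < e -> exists N, forall m n, (N <= m)%N -> (N <= n)%N -> snorm (a m - a n) < e) ->
  exists l, forall e, 0 < e -> exists N, forall n, (N <= n)%N -> snorm (l - a n) < e.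
Proof.
move=> ha.
have [|l1 h1] := @real_cauchy_lim (fun n => sre (a n)).
  move=> e /ha[N hN]; exists N => m n Nm Nn.
  by apply: le_lt_trans (hN _ _ Nm Nn); rewrite -sreN -sreD sre_norm_le.
have [|l2 h2] := @real_cauchy_lim (fun n => sim (a n)).
  move=> e /ha[N hN]; exists N => m n Nm Nn.
  by apply: le_lt_trans (hN _ _ Nm Nn); rewrite -simN -simD sim_norm_le.
have [l [el1 el2]] : exists l : scalar_field R k, sre l = l1 /\
    forall n, sim (l - a n) = sim l - sim (a n) /\
      `|sim l - sim (a n)| <= `|l2 - sim (a n)|.
  rewrite /sim; case: k a {ha} h1 h2 => a h1 h2.
    by exists l1; split => // n; rewrite subr0 normr0.
  by exists (Complex l1 l2); split => // n; split => //; case: (a n).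
exists l => e e0; have e2 : 0 < e / 2 by rewrite divr_gt0.
have [N1 hN1] := h1 _ e2; have [N2 hN2] := h2 _ e2.
exists (maxn N1 N2) => n; rewrite geq_max => /andP[/hN1 b1 /hN2 b2].
apply: le_lt_trans (snorm_le_comp _) _; rewrite sreD sreN el1 (el2 n).1.
have := (el2 n).2; lra.
Qed.

End Complete.

Section HaarDual.
Variables (R : realType) (k : scalar_kind).
Local Notation K := (scalar_field R k).
Variables (X : completeNormedModType K) (J : (R -> K) -> X).
Hypothesis hX : haar_system_space J.
Local Notation Jstep := (Jstep J).
Local Notation step_norm := (step_norm J).

Lemma dense_step (x : X) (e : R) : 0 < e -> exists m c, rnorm (x - Jstep m c) < e.
Proof.
move=> e0; have [y [z /dyadic_stepP[m [c ->]] <-] h] := dense_rnorm (hss_dense hX) x e0.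
by exists m, c.
Qed.

Lemma step_level2 (m m' : nat) (c c' : nat -> K) :
  exists M c1 c1', [/\ (m <= M)%N, step m c = step M c1 & step m' c' = step M c1'].
Proof.
have [c1 e1] := step_refine c (leq_maxl m m').
have [c2 e2] := step_refine c' (leq_maxr m m').
by exists (maxn m m'), c1, c2; rewrite e1 e2 leq_maxl.
Qed.

Lemma dyadic_step_lin (a : K) f g : dyadic_step f -> dyadic_step g ->
  dyadic_step (fun s : R => a * f s + g s).
Proof.
move=> /dyadic_stepP[m [c ->]] /dyadic_stepP[m' [c' ->]].
have [M [c1 [c1' [_ -> ->]]]] := step_level2 m m' c c'.
by rewrite step_lin; exact: dyadic_step_step.
Qed.

(** The value at [x] is the limit of the values along step functions that
    approximate [x]; characterizing it by approximation instead of a chosen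
    sequence makes linearity a consequence of uniqueness. *)
Lemma bounded_extension (psi : (R -> K) -> K) (C : R) :
  0 <= C ->
  (forall (a : K) f g, dyadic_step f -> dyadic_step g ->
     psi (fun s => a * f s + g s) = a * psi f + psi g) ->
  (forall f, dyadic_step f -> snorm (psi f) <= C * rnorm (J f)) ->
  exists phi : X -> K,
    [/\ forall (a : K) x y, phi (a *: x + y) = a * phi x + phi y,
        forall x, snorm (phi x) <= C * rnorm x &
        forall f, dyadic_step f -> phi (J f) = psi f].
Proof.
move=> C0 plin pbd.
have psiB f g : dyadic_step f -> dyadic_step g ->
    snorm (psi f - psi g) <= C * rnorm (J f - J g).
  move=> df dg; have dh := dyadic_step_lin (-1) dg df.
  have := pbd _ dh; rewrite plin// (hss_linear hX)//.
  by rewrite mulN1r scaleN1r ![- _ + _]addrC.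
pose isval x c := forall e, 0 < e -> exists f,
  [/\ dyadic_step f, rnorm (x - J f) < e & snorm (c - psi f) < e].
have uniq x c c' : isval x c -> isval x c' -> c = c'.
  move=> hc hc'; apply/eqP; rewrite -subr_eq0; apply/eqP/snorm0_eq0.
  apply/eqP; rewrite eq_le snorm_ge0 andbT; apply/ler_addgt0Pr => e e0; rewrite add0r.
  pose d := e / (2 * (C + 1)).
  have d0 : 0 < d by rewrite divr_gt0// mulr_gt0// ltr_wpDl.
  have [f [df xf cf]] := hc _ d0; have [g [dg xg cg]] := hc' _ d0.
  have h1 : snorm (c - c') <= snorm (c - psi f) + (snorm (psi f - psi g) + snorm (psi g - c')).
    apply: le_trans (@rnorm_subD _ _ K^o c (psi f) c') _.
    by rewrite lerD2l; exact: (@rnorm_subD _ _ K^o).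
  have h2 := psiB _ _ df dg.
  have h3 := rnorm_subD (J f) x (J g); rewrite [rnorm (J f - x)]rnormB in h3.
  have h4 : snorm (psi g - c') < d by rewrite snormE (@rnormB _ _ K^o).
  have h5 : C * rnorm (J f - J g) <= C * (d + d) by rewrite ler_wpM2l//; lra.
  have h6 : e = (d + d) + C * (d + d).
    by rewrite /d; field; rewrite gt_eqF// ltr_wpDl.
  lra.
have ex x : exists c, isval x c.
  have h (n : nat) : exists f, dyadic_step f /\ rnorm (x - J f) < n.+1%:R^-1.
    have n0 : 0 < n.+1%:R^-1 :> R by rewrite invr_gt0.
    by have [_ [f df <-] xf] := dense_rnorm (hss_dense hX) x n0; exists f.
  have [z hz] := choice h.
  have small (e : R) : 0 < e -> exists N, forall n, (N <= n)%N -> n.+1%:R^-1 < e.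
    move=> e0; exists (Num.truncn e^-1) => n hn.
    rewrite invf_plt ?posrE//; apply: lt_le_trans (truncnS_gt _) _.
    by rewrite ler_nat.
  have [|c hc] := @scalar_cauchy_lim _ k (fun n => psi (z n)).
    move=> e e0; have d0 : 0 < e / (2 * (C + 1)) by rewrite divr_gt0// mulr_gt0// ltr_wpDl.
    have [N hN] := small _ d0; exists N => m n /hN bm /hN bn.
    apply: le_lt_trans (psiB _ _ (hz m).1 (hz n).1) _.
    have h3 := rnorm_subD (J (z m)) x (J (z n)); rewrite [rnorm (J _ - x)]rnormB in h3.
    set d := e / _ in bm bn d0.
    have b1 := lt_trans (hz m).2 bm; have b2 := lt_trans (hz n).2 bn.
    have h5 : C * rnorm (J (z m) - J (z n)) <= C * (d + d) by rewrite ler_wpM2l//; lra.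
    have h6 : e = (d + d) + C * (d + d).
      by rewrite /d; field; rewrite gt_eqF// ltr_wpDl.
    lra.
  exists c => e e0; have [N1 h1] := small _ e0; have [N2 h2] := hc _ e0.
  exists (z (maxn N1 N2)); split; first exact: (hz _).1.
    by apply: lt_trans (hz _).2 _; apply: h1; exact: leq_maxl.
  by apply: h2; exact: leq_maxr.
have [phi hphi] := choice ex; exists phi; split.
- move=> a x y; apply: uniq (hphi _) _ => e e0.
  pose d := e / (snorm a + 2).
  have a0 := snorm_ge0 a.
  have d0 : 0 < d by rewrite divr_gt0//; lra.
  have de : snorm a * d + d < e.
    rewrite [ltRHS](_ : e = snorm a * d + d + d); first by rewrite ltrDl.
    by rewrite /d; field; lra.
  have [f [df xf cf]] := hphi x _ d0; have [g [dg yg cg]] := hphi y _ d0.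
  exists (fun s => a * f s + g s); split; first exact: dyadic_step_lin.
    rewrite (hss_linear hX)// opprD addrACA -scalerBr.
    apply: le_lt_trans (rnormD _ _) _; rewrite rnormZ; apply: le_lt_trans de.
    by apply: lerD; [rewrite ler_wpM2l// ltW|exact: ltW].
  rewrite plin// opprD addrACA -mulrBr.
  apply: le_lt_trans (@rnormD _ _ K^o _ _) _; rewrite -!snormE snormM; apply: le_lt_trans de.
  by apply: lerD; [rewrite ler_wpM2l// ltW|exact: ltW].
- move=> x; apply/ler_addgt0Pr => e e0.
  pose d := e / (C + 1).
  have d0 : 0 < d by rewrite divr_gt0// ltr_wpDl.
  have [f [df xf cf]] := hphi x _ d0.
  have h1 := pbd _ df.
  have h2 := @rnormD _ _ K^o (phi x - psi f) (psi f); rewrite subrK -!snormE in h2.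
  have h3 := rnormD (J f - x) x; rewrite subrK rnormB in h3.
  have h4 : C * rnorm (J f) <= C * (d + rnorm x) by rewrite ler_wpM2l//; lra.
  have h6 : e = d + C * d by rewrite /d; field; rewrite gt_eqF// ltr_wpDl.
  lra.
- move=> f df; apply: uniq (hphi _) _ => e e0; exists f; split => //.
    by rewrite subrr rnorm0.
  by rewrite subrr snorm0.
Qed.

End HaarDual.

(** * Haar coefficients of step functions *)

Lemma double_neqS (a b : nat) : (a.*2 == b.*2.+1) = false.
Proof. by apply/eqP => /(congr1 odd); rewrite /= !odd_double. Qed.

Lemma doubleS_neq (a b : nat) : (a.*2.+1 == b.*2) = false.
Proof. by rewrite eq_sym double_neqS. Qed.

Section HaarPairing.
Variables (R : realType) (k : scalar_kind).
Local Notation K := (scalar_field R k).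

Definition haar_coef (Q : dyadic_index) (t : nat) : K :=
  (t == (tagged Q).*2)%:R - (t == (tagged Q).*2.+1)%:R.

Definition haar_pair (L : haar_index) (f : R -> K) : K :=
  scalar_integral (fun s => haar k L s * f s).

Lemma step_refineE (m d : nat) (c : nat -> K) :
  step (R := R) m c = step (m + d) (fun i => c (iter d half i)).
Proof.
elim: d c => [|d IH] c; first by rewrite addn0.
rewrite IH stepS addnS; congr step; apply/funext => i.
by rewrite -iterSr.
Qed.

Lemma step_mul m (c c' : nat -> K) :
  (fun s => step (R := R) m c s * step m c' s) = step m (fun i => c i * c' i).
Proof.
apply/funext => s; have [Is|Is] := pselect (@unit_itv R s).
  by rewrite !step_unit.
by rewrite !step_out// mul0r.
Qed.

Lemma scalar_integral_mean m c : scalar_integral (step (R := R) (k := k) m c) = avgn m c 0%N.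
Proof.
by rewrite scalar_integral_step avgn_mean of_realV of_realX of_real_nat.
Qed.

Lemma haar_pair_root m c : haar_pair None (step m c) = avgn m c 0%N.
Proof.
rewrite /haar_pair haar_root (step_refineE 0 m) step_mul scalar_integral_mean add0n.
by apply: avgn_ext => i; rewrite mul1r.
Qed.

Lemma haar_pair_some (Q : dyadic_index) d c :
  haar_pair (Some Q) (step ((tag Q).+1 + d) c) =
  of_real k (2 ^+ (tag Q).+1)^-1 *
    (avgn d c (tagged Q).*2 - avgn d c (tagged Q).*2.+1).
Proof.
have h : ((tagged Q).*2.+1 < 2 ^ (tag Q).+1)%N.
  by rewrite expnS mul2n -doubleS leq_double.
rewrite /haar_pair haar_step -/(haar_coef Q) (step_refineE _ d) step_mul.
rewrite scalar_integral_mean avgn_add.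
rewrite (@avgn_ext _ _ _ (fun i => haar_coef Q i * avgn d c i)); last first.
  by move=> i; rewrite (avgn_mull d (haar_coef Q)).
rewrite avgn_mean of_realV of_realX of_real_nat; congr (_ * _).
rewrite (bigD1 (Ordinal h))//= (bigD1 (Ordinal (ltnW h)))//=; last first.
  by rewrite -val_eqE /= ltn_eqF.
rewrite big1 => [|i /andP[/eqP i1 /eqP i2]]; last first.
  rewrite /haar_coef; case: eqP => [e|_]; first by case: i2; apply: val_inj.
  case: eqP => [e|_]; first by case: i1; apply: val_inj.
  by rewrite subrr mul0r.
rewrite /haar_coef !eqxx (gtn_eqF (ltnSn _)) (ltn_eqF (ltnSn _)) /=.
by ring.
Qed.

Lemma haar_pair_step_level (L : haar_index) (f g : R -> K) : dyadic_step f -> dyadic_step g ->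
  exists d c c', f = step (if L is Some Q then (tag Q).+1 + d else d) c /\
                 g = step (if L is Some Q then (tag Q).+1 + d else d) c'.
Proof.
move=> /dyadic_stepP[m [c ->]] /dyadic_stepP[m' [c' ->]].
have [M [c1 [c1' [_ -> ->]]]] := step_level2 m m' c c'.
case: L => [Q|]; last by exists M, c1, c1'.
exists M, (fun i => c1 (iter (tag Q).+1 half i)), (fun i => c1' (iter (tag Q).+1 half i)).
by rewrite addnC -!step_refineE.
Qed.

Lemma avgn_lin d (a : K) c c' :
  avgn d (fun i => a * c i + c' i) =1 (fun i => a * avgn d c i + avgn d c' i).
Proof.
elim: d c c' => //= d IH c c' i; rewrite -IH; apply: avgn_ext => j.
by rewrite /avg; ring.
Qed.

Lemma haar_pair_lin L (a : K) f g : dyadic_step f -> dyadic_step g ->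
  haar_pair L (fun s => a * f s + g s) = a * haar_pair L f + haar_pair L g.
Proof.
move=> df dg; have [d [c [c' [-> ->]]]] := haar_pair_step_level L df dg.
rewrite step_lin; case: L {df dg} => [Q|].
  by rewrite !haar_pair_some !avgn_lin; ring.
by rewrite !haar_pair_root avgn_lin.
Qed.

Lemma avg_haar_coef (Q : dyadic_index) : avg (haar_coef Q) =1 (fun=> 0).
Proof.
move=> i; rewrite /avg /haar_coef double_neqS doubleS_neq eqSS !(inj_eq double_inj).
by rewrite subr0 sub0r addrN mul0r.
Qed.

(** A Haar function has mean zero on its support, on which Haar functions of
    coarser levels are constant. *)
Lemma haar_pair_haar_lt (L : haar_index) (Q : dyadic_index) :
  (if L is Some Q' then tag Q' < tag Q else true)%N ->
  haar_pair L (haar k (Some Q)) = 0.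
Proof.
rewrite haar_step -/(haar_coef Q); case: L => [Q'|_]; last first.
  rewrite haar_pair_root /= (@avgn_ext _ _ _ (fun=> 0)) ?avgn0//.
  exact: avg_haar_coef.
move=> lt; have -> : (tag Q).+1 = ((tag Q').+1 + (tag Q - tag Q').-1.+1)%N by lia.
rewrite haar_pair_some /= !(@avgn_ext _ _ (avg _) (fun=> 0)); try exact: avg_haar_coef.
by rewrite !avgn0 subrr mulr0.
Qed.

Lemma haar_pair_haarC L M : haar_pair L (haar k M) = haar_pair M (haar k L).
Proof. by congr scalar_integral; apply/funext => s; rewrite mulrC. Qed.

Lemma haar_pair_haar_same (Q Q' : dyadic_index) : tag Q = tag Q' -> Q <> Q' ->
  haar_pair (Some Q) (haar k (Some Q')) = 0.
Proof.
case: Q Q' => [j i] [j' i'] e; rewrite /= in e; subst j' => ne.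
rewrite haar_step -/(haar_coef _) [tag _]/= -[X in step X](addn0 j.+1).
rewrite (haar_pair_some (existT (fun j => 'I_(2 ^ j)) j i)) /=.
have ii : (i == i' :> nat) = false by apply/eqP => h; case: ne; congr existT; apply: val_inj.
rewrite /haar_coef /= double_neqS doubleS_neq eqSS !(inj_eq double_inj) ii.
by rewrite !subrr mulr0.
Qed.

Lemma haar_pair_haar_neq L M : L <> M -> haar_pair L (haar k M) = 0.
Proof.
case: L M => [Q|] [Q'|] //; last 2 first.
- by move=> _; rewrite haar_pair_haarC haar_pair_haar_lt.
- by move=> _; rewrite haar_pair_haar_lt.
move=> ne; case: (ltngtP (tag Q) (tag Q')) => h.
- by rewrite haar_pair_haar_lt.
- by rewrite haar_pair_haarC haar_pair_haar_lt.
- by rewrite haar_pair_haar_same// => e; apply: ne; rewrite e.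
Qed.

Lemma haar_pair_haar_eq L : haar_pair L (haar k L) = of_real k (haar_length R L).
Proof.
case: L => [Q|]; last by rewrite haar_root haar_pair_root /= of_real1.
rewrite haar_step -/(haar_coef _) -[X in step X](addn0 (tag Q).+1) haar_pair_some /=.
rewrite /haar_coef !eqxx (gtn_eqF (ltnSn _)) (ltn_eqF (ltnSn _)) /=.
rewrite !of_realV !of_realX !of_real_nat exprS invfM.
by set p := (2 ^+ tag Q)^-1; rewrite subr0 sub0r opprK; field.
Qed.

End HaarPairing.

(** * Haar functionals on a Haar system space *)

Section DualHaar.
Variables (R : realType) (k : scalar_kind).
Local Notation K := (scalar_field R k).
Variables (X : completeNormedModType K) (J : (R -> K) -> X).
Hypothesis hX : haar_system_space J.

Definition haar_norm (L : haar_index) : R := rnorm (J (haar k L)).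

Lemma haar_norm_some (Q : dyadic_index) :
  haar_norm (Some Q) = step_norm J (tag Q) (point R k (tagged Q)).
Proof.
rewrite /haar_norm haar_step -/(haar_coef R k Q) /step_norm [in RHS]JstepS.
apply: (step_norm_abs hX) => t _; rewrite /haar_coef /point.
have [e|e] := double_or_doubleS t; rewrite [in LHS]e.
  by rewrite (inj_eq double_inj) double_neqS subr0.
rewrite eqSS (inj_eq double_inj) doubleS_neq sub0r.
exact: (@rnormN _ _ K^o).
Qed.

Lemma haar_norm_root : haar_norm None = 1.
Proof. by rewrite /haar_norm /haar /rnorm (hss_unit hX) -of_real1 of_realK. Qed.

Lemma haar_norm_le1 L : haar_norm L <= 1.
Proof.
case: L => [Q|]; last by rewrite haar_norm_root.
by rewrite haar_norm_some step_norm_point_le1.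
Qed.

Lemma haar_norm_ge L : haar_length R L <= haar_norm L.
Proof.
case: L => [Q|]; last by rewrite haar_norm_root.
by rewrite haar_norm_some step_norm_point_gt.
Qed.

Lemma haar_length_gt0 L : 0 < haar_length R L.
Proof. by case: L => [Q|] //=; rewrite invr_gt0. Qed.

Lemma haar_norm_gt0 L : 0 < haar_norm L.
Proof. exact: lt_le_trans (haar_length_gt0 L) (haar_norm_ge L). Qed.

Lemma haar_dyadic L : dyadic_step (haar (R := R) k L).
Proof.
by case: L => [Q|]; [rewrite haar_step|rewrite haar_root]; exact: dyadic_step_step.
Qed.

(** The pairing with [h_L] is at most [|L|] times the mean of the modulus over
    [L], and [local_mean] controls this mean times the norm of [h_L]. *)
Lemma haar_pair_bound L f : dyadic_step f ->
  snorm (haar_pair L f) <= haar_length R L / haar_norm L * rnorm (J f).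
Proof.
move=> df; rewrite mulrAC ler_pdivlMr ?haar_norm_gt0//.
have [d [c [_ [-> _]]]] := haar_pair_step_level L df df.
case: L {df} => [Q|]; last first.
  rewrite haar_pair_root haar_norm_root mulr1 mul1r.
  by apply: le_trans (snorm_avgn _ _ _) _; exact: step_norm_mean.
rewrite haar_pair_some haar_norm_some /haar_length snormM snorm_of_real ger0_norm ?invr_ge0//.
rewrite -mulrA exprS invfM -!mulrA [X in X <= _]mulrCA ler_wpM2l ?invr_ge0//.
have lm := local_mean hX (tag Q) d.+1 c (tagged Q); rewrite addnS -addSn in lm.
apply: le_trans lm.
rewrite mulrA ler_wpM2r ?step_norm_ge0// avgnSl /avg mulrC ler_wpM2r ?invr_ge0//.
apply: le_trans (@rnormD _ _ K^o _ _) _; rewrite (@rnormN _ _ K^o).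
by rewrite lerD// snorm_avgn.
Qed.

Notation phi L := (dual_of J (haar k L)).

Lemma dual_ratio_ge0 L : 0 <= haar_length R L / haar_norm L.
Proof. by rewrite divr_ge0// ltW ?haar_length_gt0 ?haar_norm_gt0. Qed.

Lemma is_dual_haar L : is_dual_of J (haar k L) (phi L).
Proof.
suff [p hp] : exists p, is_dual_of J (haar k L) p.
  by apply: (xgetPex (fun=> 0)); exists p.
have [p [plin pbd pJ]] := bounded_extension hX (dual_ratio_ge0 L)
  (fun a f g => @haar_pair_lin R k L a f g) (@haar_pair_bound L).
exists p; split=> //.
move=> x; apply/cvgrPdist_lt => e e0.
have ee : of_real k (sre e) = e by rewrite sreK// ltW.
have e0' : 0 < sre e by rewrite -(@of_real_lt _ k) ee of_real0.
set C := _ / _ in pbd.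
have C0 : 0 <= C := dual_ratio_ge0 L.
have d0 : 0 < sre e / (C + 1) by rewrite divr_gt0// ltr_wpDl.
have d0' : 0 < of_real k (sre e / (C + 1)) by rewrite -(@of_real0 R k) of_real_lt.
apply/nbhs_ballP; exists (of_real k (sre e / (C + 1))) => //= y.
rewrite -ball_normE /= -of_real_norm of_real_lt => xy.
have -> : p x - p y = p (x - y).
  by rewrite addrC -[in RHS](scaleN1r y) [in RHS]addrC plin mulN1r.
rewrite -ee -[X in X < _](@of_real_norm _ _ K^o) of_real_lt.
apply: le_lt_trans (pbd _) _; rewrite ltr_pdivlMr ?ltr_wpDl// in xy.
apply: le_lt_trans xy; rewrite mulrC ler_wpM2l ?rnorm_ge0// lerDl//.
Qed.

Lemma dual_haar_lin L (a : K) x y : phi L (a *: x + y) = a * phi L x + phi L y.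
Proof. by case: (is_dual_haar L). Qed.

Lemma dual_haar0 L : phi L 0 = 0.
Proof.
have := dual_haar_lin L 1 0 0; rewrite scaler0 addr0 mul1r -[X in X = _]addr0.
by move/addrI.
Qed.

Lemma dual_haarZ L (a : K) x : phi L (a *: x) = a * phi L x.
Proof. by rewrite -[a *: x]addr0 dual_haar_lin dual_haar0 addr0. Qed.

Lemma dual_haarB L x y : phi L (x - y) = phi L x - phi L y.
Proof. by rewrite addrC -scaleN1r dual_haar_lin mulN1r addrC. Qed.

Lemma dual_haar_step L f : dyadic_step f -> phi L (J f) = haar_pair L f.
Proof. by case: (is_dual_haar L) => _ _ h /h. Qed.

Lemma dual_haar_bound L x : snorm (phi L x) <= haar_length R L / haar_norm L * rnorm x.
Proof.
set C := _ / _; have C0 : 0 <= C := dual_ratio_ge0 L.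
apply/ler_addgt0Pr => e e0.
pose e1 := e / (C + 1).
have e10 : 0 < e1 by rewrite divr_gt0// ltr_wpDl.
have e10' : 0 < of_real k e1 by rewrite -(@of_real0 R k) of_real_lt.
have [_ cphi _] := is_dual_haar L.
have /cvgrPdist_lt /(_ _ e10') /nbhs_ballP [d /= d0 hd] := cphi x.
have dd : of_real k (sre d) = d by rewrite sreK// ltW.
have d0' : 0 < sre d by rewrite -(@of_real_lt _ k) dd of_real0.
have m0 : 0 < Num.min (sre d) e1 by rewrite lt_min d0' e10.
have [m [c]] := dense_step hX x m0; rewrite lt_min => /andP[h1 h2].
have b1 : snorm (phi L x - phi L (Jstep J m c)) < e1.
  rewrite -(@of_real_lt _ k) (@of_real_norm _ _ K^o); apply: hd.
  by rewrite -ball_normE /= -of_real_norm -dd of_real_lt.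
have b2 : snorm (phi L (Jstep J m c)) <= C * rnorm (Jstep J m c).
  by rewrite dual_haar_step; [apply: haar_pair_bound|]; exact: dyadic_step_step.
have b3 := rnormD (Jstep J m c - x) x; rewrite subrK rnormB in b3.
have b4 := @rnormD _ _ K^o (phi L x - phi L (Jstep J m c)) (phi L (Jstep J m c)).
rewrite subrK -!snormE in b4.
have b5 : C * rnorm (Jstep J m c) <= C * (e1 + rnorm x) by rewrite ler_wpM2l//; lra.
have b6 : e = e1 + C * e1 by rewrite /e1; field; rewrite gt_eqF// ltr_wpDl.
lra.
Qed.

(** The bound on the Haar functional is attained at the normalized Haar
    function. *)
Lemma dual_haar_norm L : dual_norm (phi L) = haar_length R L / haar_norm L.
Proof.
have hn := haar_norm_gt0 L; have hl := haar_length_gt0 L.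
set A := [set snorm (phi L x) | x in [set x : X | rnorm x <= 1]].
have ub : ubound A (haar_length R L / haar_norm L).
  move=> _ [x /= x1 <-]; apply: le_trans (dual_haar_bound _ _) _.
  by rewrite -[leRHS]mulr1 ler_wpM2l// dual_ratio_ge0.
have at_max : A (haar_length R L / haar_norm L).
  exists (of_real k (haar_norm L)^-1 *: J (haar k L)).
    by rewrite /= rnormZ snorm_of_real gtr0_norm ?invr_gt0// mulVf// gt_eqF.
  rewrite dual_haarZ dual_haar_step; last exact: haar_dyadic.
  rewrite haar_pair_haar_eq snormM !snorm_of_real !gtr0_norm ?invr_gt0//.
  by rewrite mulrC.
apply/eqP; rewrite eq_le; apply/andP; split.
  by apply: sup_le_ub => //; exists (haar_length R L / haar_norm L).
by apply: ub_le_sup => //; exists (haar_length R L / haar_norm L).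
Qed.

(** The normalizations make [nu_L h_L] and [mu_L h_L] biorthogonal. *)
Lemma haar_nu_mu L : haar_nu J L * haar_mu J L = of_real k (haar_length R L)^-1.
Proof.
have hn := haar_norm_gt0 L; have hl := haar_length_gt0 L.
rewrite /haar_nu /haar_mu dual_haar_norm -of_real_norm -/(haar_norm L).
rewrite -of_realV -of_realM; congr of_real.
by field; rewrite !gt_eqF.
Qed.

Lemma dual_haar_le L x : snorm (phi L x) <= rnorm x.
Proof.
apply: le_trans (dual_haar_bound L x) _.
by rewrite ler_piMl ?rnorm_ge0// ler_pdivrMr ?haar_norm_gt0// mul1r haar_norm_ge.
Qed.

(** Small Haar coefficients force a small conditional expectation: the
    difference of consecutive conditional expectations is a combination of
    Haar functions of one level. *)
Lemma step_norm_haar_coef n d c eta :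
  (forall L, snorm (haar_pair L (step (R := R) (k := k) (n + d) c)) <= eta) ->
  step_norm J n (avgn d c) <= 4 ^+ n * eta.
Proof.
elim: n d => [|n IH] d h.
  rewrite step_norm_level0// expr0 mul1r; have := h None.
  by rewrite haar_pair_root add0n.
have h0 : 0 <= eta by apply: le_trans (h None); exact: snorm_ge0.
have IH1 : step_norm J n (avgn d.+1 c) <= 4 ^+ n * eta by apply: IH; rewrite addnS -addSn.
pose e := avgn d c.
pose D (i : nat) : K := (e i.*2 - e i.*2.+1) / 2.
have eE t : e t = avg e t./2 + D t./2 * (-1) ^+ odd t.
  rewrite /avg /D; have [] := double_or_doubleS t; generalize t./2 => j ->.
    by rewrite odd_double expr0; field.
  by rewrite /= odd_double expr1; field.
have jD : step_norm J n.+1 (fun t => D t./2 * (-1) ^+ odd t) <= \sum_(i < 2 ^ n) snorm (D i).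
  rewrite (@step_norm_abs _ _ _ _ hX _ (fun t => D t./2)); last first.
    move=> t _; rewrite snormM; case: (odd t); last by rewrite snorm1 mulr1.
    by rewrite expr1 -of_real1 -of_realN snorm_of_real normrN1 mulr1.
  rewrite /step_norm -JstepS (@eq_Jstep _ _ _ _ _ _ (fun t => \sum_(i < 2 ^ n) D i * point R k i t)).
    rewrite (Jstep_sum hX); apply: le_trans (rnorm_sum _ _ _) _.
    apply: ler_sum => i _; rewrite (JstepZ hX) rnormZ.
    by rewrite ler_piMr ?snorm_ge0//; exact: (step_norm_point_le1 hX).
  move=> t tn; rewrite (bigD1 (Ordinal tn))//= /point eqxx mulr1 big1 ?addr0// => i it.
  rewrite (_ : (t == i) = false) ?mulr0//.
  by apply: contra_neqF it => /eqP ti; apply: val_inj.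
have Dle (i : 'I_(2 ^ n)) : snorm (D i) <= 2 ^+ n * eta.
  have := h (Some (Tagged (fun j => 'I_(2 ^ j)) i)).
  rewrite haar_pair_some /= -/e snormM snorm_of_real ger0_norm ?invr_ge0//.
  rewrite ler_pdivrMl// exprS -mulrA => hi.
  rewrite /D snormM snorm_half ler_pdivrMr// mulrC//.
have sD : \sum_(i < 2 ^ n) snorm (D i) <= 4 ^+ n * eta.
  apply: le_trans (ler_sum _ (fun i _ => Dle i)) _.
  rewrite sumr_const card_ord -[_ *+ _]mulr_natl natrX mulrA -exprMn.
  by rewrite (_ : 2 * 2 = 4 :> R)//; ring.
have := step_normD hX n.+1 (fun t => avg e t./2) (fun t => D t./2 * (-1) ^+ odd t).
rewrite (@eq_step_norm _ _ _ J n.+1 _ e); last by move=> t _; rewrite -eE.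
rewrite {2}/step_norm -JstepS -/(step_norm J n _) (@eq_step_norm _ _ _ J n (avg e) (avgn d.+1 c)); last first.
  by move=> i _; rewrite avgnSl.
have p0 : 0 <= 4 ^+ n * eta by rewrite mulr_ge0// exprn_ge0.
rewrite exprS -mulrA; lra.
Qed.

(** Two approximations of [x] by step functions are compared: a first one of
    some level [n], then a second one so close to [x] that its Haar
    coefficients, hence its conditional expectation on level [n], are small. *)
Lemma haar_separate (x : X) : (forall L, phi L x = 0) -> x = 0.
Proof.
move=> hx; apply: rnorm0_eq0; apply/eqP; rewrite eq_le rnorm_ge0 andbT.
apply/ler_addgt0Pr => e e0; rewrite add0r.
have d0 : 0 < e / 4 by rewrite divr_gt0.
have [n [c hc]] := dense_step hX x d0.
pose eta := e / 4 / 4 ^+ n.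
have eta0 : 0 < eta by rewrite divr_gt0// exprn_gt0.
have m0 : 0 < Num.min eta (e / 4) by rewrite lt_min eta0 d0.
have [m0' [c0]] := dense_step hX x m0; rewrite lt_min => /andP[h1 h2].
have [d [c' e']] : exists d c', step (R := R) m0' c0 = step (n + d) c'.
  by exists m0', (fun i => c0 (iter n half i)); rewrite addnC -step_refineE.
rewrite /Jstep e' -/(Jstep J _ _) in h1 h2.
have b1 : step_norm J n (avgn d c') <= 4 ^+ n * eta.
  apply: step_norm_haar_coef => L; rewrite -dual_haar_step; last exact: dyadic_step_step.
  rewrite -(subr0 (phi _ _)) -(hx L) -dual_haarB.
  by apply: le_trans (dual_haar_le _ _) _; rewrite rnormB ltW.
have eta4 : 4 ^+ n * eta = e / 4 by rewrite /eta mulrC divfK// gt_eqF// exprn_gt0.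
have b2 : step_norm J n (fun i => c i - avgn d c' i) <= rnorm (Jstep J n c - Jstep J (n + d) c').
  have -> : Jstep J n c - Jstep J (n + d) c' = Jstep J (n + d) (fun i => c (iter d half i) - c' i).
    rewrite (Jstep_refine J n d c) addrC -scaleN1r -(Jstep_lin hX).
    by apply: eq_Jstep => i _; rewrite mulN1r addrC.
  apply: le_trans (step_norm_avgn hX n d _).
  rewrite (@eq_step_norm _ _ _ J n _ (avgn d (fun i => c (iter d half i) - c' i)))// => i _.
  rewrite [RHS](@avgn_ext _ d _ (fun i => (-1) * c' i + c (iter d half i) * 1)); last first.
    by move=> t; ring.
  rewrite avgn_lin (avgn_mull d c (fun=> 1)) mulN1r [RHS]addrC; congr (_ - _).
  suff -> : avgn d (fun=> 1) i = 1 :> K by rewrite mulr1.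
  elim: d {e' h1 h2 b1} i => //= d IH i; rewrite -[RHS](IH i); apply: avgn_ext => t.
  by rewrite /avg; field.
have b3 := rnorm_subD (Jstep J n c) x (Jstep J (n + d) c').
rewrite [rnorm (Jstep J n c - x)]rnormB in b3.
have b4 : step_norm J n c <= step_norm J n (fun i => c i - avgn d c' i) + step_norm J n (avgn d c').
  apply: le_trans (step_normD hX n _ _).
  by rewrite (@eq_step_norm _ _ _ J n _ c)// => i _; rewrite subrK.
have b5 := rnormD (x - Jstep J n c) (Jstep J n c); rewrite subrK -/(step_norm J n c) in b5.
rewrite eta4 in b1; lra.
Qed.

End DualHaar.

(** * X-diagonal operators on Haar functions *)

Section Testing.
Variables (R : realType) (k : scalar_kind).
Local Notation K := (scalar_field R k).
Local Notation mu := (@lebesgue_measure R).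
Local Notation I01 := (@unit_itv R).

Lemma in_L1_lip (V W : normedModType K) (f : V -> W) (C : R) (u : R -> V) :
  0 <= C -> (forall x y, rnorm (f x - f y) <= C * rnorm (x - y)) ->
  (forall x, rnorm (f x) <= C * rnorm x) -> in_L1 u -> in_L1 (f \o u).
Proof.
move=> C0 flip fbd [su u1]; have sfu : strongly_measurable (f \o u).
  by apply: smeas_lip su; exists C.
split=> //; apply: (@le_lt_trans _ _ (C%:E * L1norm u)%E).
  rewrite /L1norm -ge0_integralZl_EFin//; last 2 first.
  - by move=> s _; rewrite lee_fin rnorm_ge0.
  - exact: smeas_ernorm.
  apply: ge0_le_integral => //.
  - by move=> s _; rewrite lee_fin rnorm_ge0.
  - exact: smeas_ernorm.
  - by apply: measurable_funeM; exact: smeas_ernorm.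
  - by move=> s _; rewrite -EFinM lee_fin; exact: fbd.
by rewrite lte_mul_pinfty// lee_fin.
Qed.

Lemma L1_integrable (g : R -> R) (F : R -> K) : in_L1 (F : R -> K^o) ->
  measurable_fun I01 g -> (forall s, `|g s| <= snorm (F s)) ->
  mu.-integrable I01 (EFin \o g).
Proof.
move=> [sF F1] mg gF; apply/integrableP; split; first exact/measurable_EFinP.
apply: le_lt_trans F1; apply: ge0_le_integral => //.
- by apply: measurableT_comp => //; exact/measurable_EFinP.
- exact: (@smeas_ernorm _ _ K^o).
- by move=> s _; rewrite /= lee_fin gF.
Qed.

Lemma real_test_eq (f g : R -> R) :
  mu.-integrable I01 (EFin \o f) -> mu.-integrable I01 (EFin \o g) ->
  (forall A, measurable A ->
     Rintegral mu I01 (fun s => \1_A s * f s) = Rintegral mu I01 (fun s => \1_A s * g s)) ->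
  {ae mu, forall s, I01 s -> f s = g s}.
Proof.
move=> fi gi fg.
have mg : measurable_fun I01 (EFin \o g) by case/integrableP: gi.
have key (h : R -> R) E : mu.-integrable I01 (EFin \o h) -> E `<=` I01 -> measurable E ->
    (\int[mu]_(x in E) (EFin \o h) x)%E = (Rintegral mu I01 (fun s => \1_E s * h s))%:E.
  move=> hi EI mE; have hE : mu.-integrable E (EFin \o h) by apply: integrableS hi.
  rewrite -[LHS]fineK; last exact: integrable_fin_num.
  congr EFin; rewrite -{1}(setIidr EI).
  have -> : fine (\int[mu]_(x in I01 `&` E) (EFin \o h) x)%E = Rintegral mu (I01 `&` E) h by [].
  rewrite Rintegral_mkcondr; apply: eq_Rintegral => s _.
  by rewrite patchE indicE; case: (s \in E); rewrite ?mul1r ?mul0r.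
have := @integral_ae_eq _ _ _ mu I01 (@measurable_unit R) _ _ fi mg.
move=> /(_ _)/wrap[E EI mE|].
  by rewrite !key// fg.
apply: ae_imp => s h Is.
by have := h Is; case.
Qed.

(** Indicator functions are real, so they test real and imaginary parts
    separately. *)
Lemma L1_test_eq (F G : R -> K) : in_L1 (F : R -> K^o) -> in_L1 (G : R -> K^o) ->
  (forall A, measurable A -> scalar_integral (fun s => \1_A s * F s) =
                             scalar_integral (fun s => \1_A s * G s)) ->
  ae_eq_fun (F : R -> K^o) G.
Proof.
move=> F1 G1 FG.
have reF : {ae mu, forall s, I01 s -> sre (F s) = sre (G s)}.
  apply: real_test_eq.
  - by apply: (L1_integrable F1) => [|s]; [exact: smeas_sre F1.1|exact: sre_norm_le].
  - by apply: (L1_integrable G1) => [|s]; [exact: smeas_sre G1.1|exact: sre_norm_le].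
  - move=> A /FG /(congr1 (@sre _ _)); rewrite !sre_scalar_integral.
    by under eq_Rintegral do rewrite indicK sreZ; under [RHS]eq_Rintegral do rewrite indicK sreZ.
have imF : {ae mu, forall s, I01 s -> sim (F s) = sim (G s)}.
  apply: real_test_eq.
  - by apply: (L1_integrable F1) => [|s]; [exact: smeas_sim F1.1|exact: sim_norm_le].
  - by apply: (L1_integrable G1) => [|s]; [exact: smeas_sim G1.1|exact: sim_norm_le].
  - move=> A /FG /(congr1 (@sim _ _)); rewrite !sim_scalar_integral.
    by under eq_Rintegral do rewrite indicK simZ; under [RHS]eq_Rintegral do rewrite indicK simZ.
by move: reF imF; apply: ae_imp2 => s h1 h2 Is; apply: scalar_ext; [exact: h1|exact: h2].
Qed.

Lemma smeas_indic (A : set R) : measurable A -> strongly_measurable (\1_A : R -> K^o).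
Proof.
move=> mA; apply: smeas_simple; exists 1%N, (fun=> A), (fun=> 1); split=> //.
by apply/funext => s; rewrite big_ord1 /GRing.scale /= mulr1.
Qed.

Lemma snorm_indic_le1 (A : set R) s : snorm (\1_A s : K) <= 1.
Proof. by rewrite indicE; case: (_ \in _); rewrite ?snorm1 ?snorm0. Qed.

Lemma in_Linfty_indic (A : set R) : measurable A -> in_Linfty (\1_A : R -> K).
Proof.
move=> mA; split; first exact: smeas_indic.
by exists 1; apply: aeW => s _; exact: snorm_indic_le1.
Qed.

Lemma ae_forall_count (I : countType) (P : I -> R -> Prop) :
  (forall i, {ae mu, forall s, P i s}) -> {ae mu, forall s, forall i, P i s}.
Proof.
move=> h; have := @ae_foralln _ _ _ mu
  (fun n s => if unpickle n is Some i then P i s else True).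
move=> /(_ _)/wrap[n|].
  by case: (unpickle n) => [i|]; [exact: h|exact: aeW].
by apply: ae_imp => s hs i; have := hs (pickle i); rewrite pickleK.
Qed.

End Testing.

Section DiagonalOnHaar.
Variables (R : realType) (k : scalar_kind).
Local Notation K := (scalar_field R k).
Variables (X : completeNormedModType K) (J : (R -> K) -> X).
Hypothesis hX : haar_system_space J.
Variable T : (R -> X) -> (R -> X).
Hypothesis hT : X_diagonal J T.
Variable TD : haar_index -> (R -> K^o) -> (R -> K^o).
Hypothesis hTD : forall L, is_entry J T L L (TD L).

Notation phi L := (dual_of J (haar k L)).

Lemma in_L1_dual (a : K) L (u : R -> X) : in_L1 u ->
  in_L1 ((fun s => a * phi L (u s)) : R -> K^o).
Proof.
move=> u1; apply: (@in_L1_lip _ _ X K^o (fun x => a * phi L x) (snorm a)) u1.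
- exact: snorm_ge0.
- move=> x y; rewrite -mulrBr -(dual_haarB hX) -snormE snormM.
  by rewrite ler_wpM2l ?snorm_ge0// (dual_haar_le hX).
- by move=> x; rewrite -snormE snormM ler_wpM2l ?snorm_ge0// (dual_haar_le hX).
Qed.

Lemma entry_ae L M E (f : R -> K) : is_entry J T L M E -> in_L1 (f : R -> K^o) ->
  ae_eq_fun (E f) (fun s => haar_nu J L * phi L (T (tensor f (haar_mu J M *: J (haar k M))) s)).
Proof.
move=> [bE hE] f1; apply: L1_test_eq.
- exact: (L1op_in_L1 bE).
- by apply: in_L1_dual; apply: (L1op_in_L1 hT.1); exact: in_L1_tensor.
- by move=> A mA; rewrite hE//; exact: in_Linfty_indic.
Qed.

Lemma haar_nu_neq0 L : haar_nu J L != 0.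
Proof.
apply: contraNneq (_ : of_real k (haar_length R L)^-1 != 0) => [e|].
  by rewrite -(haar_nu_mu hX) e mul0r.
by rewrite -(of_real0 R k) (inj_eq (@of_real_inj R k)) invr_eq0 gt_eqF// haar_length_gt0.
Qed.

(** All Haar functionals but that of [M] annihilate [T (f (x) h_M)] almost
    everywhere, so that its values lie on the line of [h_M]. *)
Lemma diagonal_haar M (f : R -> K) : in_L1 (f : R -> K^o) ->
  ae_eq_fun (T (tensor f (J (haar k M)))) (tensor (TD M f) (J (haar k M))).
Proof.
move=> f1; set hM := J (haar k M); set m := haar_mu J M.
have bT := hT.1.
have nm := haar_nu_mu hX M; rewrite -/m in nm.
have m0 : m != 0.
  apply: contraNneq (haar_nu_neq0 M) => e.
  move: nm; rewrite e mulr0 => /esym/eqP.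
  by rewrite -(of_real0 R k) (inj_eq (@of_real_inj R k)) invr_eq0 gt_eqF// haar_length_gt0.
set u := T (tensor f (m *: hM)).
have huL : {ae @lebesgue_measure R, forall s, forall L, @unit_itv R s -> L <> M -> phi L (u s) = 0}.
  apply: ae_forall_count => L; have [->|LM] := pselect (L = M); first exact: aeW.
  have := entry_ae (hT.2 L M LM) f1; apply: ae_imp => s h Is _.
  by have /esym/eqP := h Is; rewrite mulf_eq0 (negbTE (haar_nu_neq0 L)) => /eqP.
have huM := entry_ae (hTD M) f1; rewrite -/m -/hM -/u in huM.
have uE : ae_eq_fun u (tensor (TD M f) (m *: hM)).
  move: huL huM; apply: ae_imp2 => s hL hMs Is.
  apply/eqP; rewrite -subr_eq0; apply/eqP; apply: (haar_separate hX) => L.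
  rewrite (dual_haarB hX) /tensor !(dual_haarZ hX) (dual_haar_step hX); last exact: haar_dyadic.
  have [->|LM] := pselect (L = M).
    rewrite hMs// haar_pair_haar_eq.
    have e : haar_nu J M * (m * of_real k (haar_length R M)) = 1.
      by rewrite mulrA nm -of_realM mulVf ?of_real1// gt_eqF// haar_length_gt0.
    by rewrite mulrAC e mul1r subrr.
  by rewrite hL// haar_pair_haar_neq// !mulr0 subr0.
have := L1opZ bT m^-1 (in_L1_tensor (m *: hM) f1).
rewrite (_ : (fun s => _) = tensor f hM); last first.
  by apply/funext => s; rewrite /tensor !scalerA mulrAC mulVf// mul1r.
move: uE; apply: ae_imp2 => s h1 h2 Is.
by rewrite h2// -/u h1// /tensor !scalerA mulrAC mulVf// mul1r.
Qed.

End DiagonalOnHaar.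

(** * Pointwise estimate of a Haar multiplier *)

Lemma scale_identity (F : comNzRingType) (V : lmodType F) (r b o a q : F) (m p h j : V) :
  r *: (m + o *: (a *: h)) - b *: (r *: (p + o *: h) - (r * q) *: j) =
  r *: ((m - b *: (p - q *: j)) + (o * (a - b)) *: h).
Proof.
rewrite -[(r * q) *: j]scalerA -scalerBr [b *: (r *: _)]scalerA [b * r]mulrC.
rewrite -[(r * b) *: _]scalerA -scalerBr; congr (_ *: _).
rewrite (addrAC p) [b *: (_ + o *: h)]scalerDr opprD mulrBr scalerBl.
by rewrite !scalerA [b * o]mulrC addrACA.
Qed.

Lemma scale_split (F : comNzRingType) (V : lmodType F) (c a q : F) (m p j : V) :
  c *: m = c *: (m - a *: (p - q *: j)) - (q * c * a) *: j + (c * a) *: p.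
Proof.
rewrite scalerBr scalerA [(c * a) *: (_ - _)]scalerBr scalerA.
have -> : q * c * a = c * a * q by rewrite -mulrA mulrC.
by rewrite opprB [X in _ + X - _]addrC addrA addrK subrK.
Qed.

Section Multiplier.
Variables (R : realType) (k : scalar_kind).
Local Notation K := (scalar_field R k).
Variables (X : completeNormedModType K) (J : (R -> K) -> X).
Hypothesis hX : haar_system_space J.
Local Notation Jstep := (Jstep J).
Local Notation step_norm := (step_norm J).
Local Notation point := (point R k).

Definition node (n i : nat) : haar_index :=
  if insub i is Some i' then Some (Tagged (fun j => 'I_(2 ^ j)) (i' : 'I_(2 ^ n)))
  else None.

Lemma nodeE n i (h : (i < 2 ^ n)%N) :
  node n i = Some (Tagged (fun j => 'I_(2 ^ j)) (Ordinal h)).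
Proof. by rewrite /node insubT. Qed.

Local Notation H n i := (J (haar k (node n i))).

Lemma half_lt n i : (i < 2 ^ n.+1)%N -> (i./2 < 2 ^ n)%N.
Proof. by rewrite expnS mul2n ltn_half_double. Qed.

Lemma iter_half_lt n d i : (i < 2 ^ (n + d))%N -> (iter d half i < 2 ^ n)%N.
Proof.
elim: d i => [|d IH] i; first by rewrite addn0.
by rewrite addnS => /half_lt /IH; rewrite iterSr.
Qed.

(** The indicator of a half of an interval is half the indicator of the
    interval plus or minus half its Haar function. *)
Lemma Jstep_pointS n i : (i < 2 ^ n.+1)%N ->
  Jstep n.+1 (point i) = 2^-1 *: (Jstep n (point i./2) + (-1) ^+ odd i *: H n i./2).
Proof.
move=> ilt; have -> : H n i./2 =
    Jstep n.+1 (haar_coef R k (Tagged (fun j => 'I_(2 ^ j)) (Ordinal (half_lt ilt)))).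
  by rewrite (nodeE (half_lt ilt)) haar_step.
rewrite [Jstep n _]JstepS -(JstepZ hX) -(JstepD hX) -(JstepZ hX).
apply: eq_Jstep => t _; rewrite /haar_coef /point /=.
have [] := double_or_doubleS i; have [] := double_or_doubleS t;
  generalize i./2 => j; generalize t./2 => l -> ->;
  rewrite /= ?odd_double /= ?doubleK ?uphalf_double ?eqSS ?(inj_eq double_inj)
    ?double_neqS ?doubleS_neq; case: (l == j); rewrite ?expr0 ?expr1 /=; by field.
Qed.

Lemma step_norm_blocks n d (beta : nat -> K) (c : nat -> K) :
  step_norm (n + d) (fun i => beta (iter d half i) * c i) <=
  (\sum_(l < 2 ^ n) snorm (beta l)) * step_norm (n + d) c.
Proof.
rewrite (@eq_step_norm _ _ _ J _ _ (fun i => \sum_(l < 2 ^ n) beta l * ((iter d half i == l)%:R * c i))).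
  rewrite /step_norm (Jstep_sum hX) mulr_suml; apply: le_trans (rnorm_sum _ _ _) _.
  apply: ler_sum => l _; rewrite (JstepZ hX) rnormZ ler_wpM2l ?snorm_ge0//.
  exact: (step_norm_restrict hX _ (fun i => iter d half i == l)).
move=> i ilt; rewrite (bigD1 (Ordinal (iter_half_lt ilt)))//= eqxx mul1r big1 ?addr0// => l hl.
rewrite (_ : (_ == _) = false) ?mul0r ?mulr0//.
by apply: contra_neqF hl => /eqP e; apply: val_inj.
Qed.

Section Family.
Variable alpha : nat -> nat -> K.

(** The value at one point of [0, 1) of the difference of operators on
    [f (x) 1_I], written along the ancestors of [I]; here [alpha n i] is the
    difference of the entries of the [i]-th interval of level [n] and of the
    root. *)
Fixpoint multiplier_point (n i : nat) : X :=
  if n is m.+1 then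
    2^-1 *: (multiplier_point m i./2 + (-1) ^+ odd i *: (alpha m i./2 *: H m i./2))
  else 0.

(** The sum of [|alpha - b|] over the strict ancestors of an interval of level
    [n], the ancestor of level [m] having weight [2 ^ m / 2 ^ n]. *)
Fixpoint path_dev (n i : nat) (b : K) : R :=
  if n is m.+1 then 2^-1 * (path_dev m i./2 b + snorm (alpha m i./2 - b)) else 0.

(** It starts at level 1 by the distance to the root: comparing level 1 to the
    root through level 0 would cost one more unit. *)
Fixpoint level_var (n : nat) : R :=
  if n is m.+1 then
    level_var m + \sum_(l < 2 ^ m.+2) snorm (alpha m.+2 l - alpha m.+1 l./2)
  else \sum_(l < 2 ^ 1) snorm (alpha 1 l).

(** If all values of [alpha] at the ancestors of [I] were equal to [b], then
    [multiplier_point] would be [b] times the difference of [1_I] and its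
    mean. *)
Lemma multiplier_point_dev n i b : (i < 2 ^ n)%N ->
  rnorm (multiplier_point n i - b *: (Jstep n (point i) - of_real k (2 ^+ n)^-1 *: J (haar k None)))
  <= path_dev n i b.
Proof.
elim: n i => [|n IH] i ilt.
  move: ilt; rewrite expn0 ltnS leqn0 => /eqP -> /=.
  rewrite expr0 invr1 of_real1 scale1r (_ : Jstep 0 _ = J (haar k None)).
    by rewrite subrr scaler0 subr0 rnorm0.
  by rewrite haar_root; apply: eq_Jstep; case.
have hlt := half_lt ilt; have {}IH := IH _ hlt.
rewrite Jstep_pointS//= exprS invfM of_realM of_realV of_real_nat.
set h := H n i./2; set J1 := J _; set p := Jstep n _; set q := of_real k _.
have -> : 2^-1 *: (multiplier_point n i./2 + (-1) ^+ odd i *: (alpha n i./2 *: h)) -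
    b *: (2^-1 *: (p + (-1) ^+ odd i *: h) - (2^-1 * q) *: J1) =
    2^-1 *: ((multiplier_point n i./2 - b *: (p - q *: J1)) +
             ((-1) ^+ odd i * (alpha n i./2 - b)) *: h).
  exact: scale_identity.
rewrite rnormZ snorm_half ler_wpM2l ?invr_ge0//.
apply: le_trans (rnormD _ _) _; apply: lerD; first exact: IH.
rewrite rnormZ snormM (_ : snorm ((-1) ^+ odd i : K) = 1) ?mul1r; last first.
  by case: (odd i); rewrite ?expr0 ?snorm1// expr1 -of_real1 -of_realN snorm_of_real normrN1.
by rewrite ler_piMr ?snorm_ge0//; exact: haar_norm_le1.
Qed.

(** Telescoping [alpha] along the levels leaves, for every level, coefficients
    that are constant on its intervals; cutting to each of these intervals is a
    contraction. *)
Lemma step_norm_level_var n (c : nat -> K) :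
  step_norm n.+1 (fun i => alpha n.+1 i * c i) <= level_var n * step_norm n.+1 c.
Proof.
suff h m d : (m + d = n)%N ->
    step_norm n.+1 (fun i => alpha m.+1 (iter d half i) * c i) <= level_var m * step_norm n.+1 c.
  by apply: (h n 0); rewrite addn0.
elim: m d => [|m IH] d e.
  by rewrite -e; have := @step_norm_blocks 1 d (alpha 1) c; rewrite add0n add1n.
have {}IH := IH d.+1 _; rewrite addnS -addSn in IH; have {}IH := IH e.
rewrite (@eq_step_norm _ _ _ J _ _ (fun i => alpha m.+1 (iter d.+1 half i) * c i +
   (alpha m.+2 (iter d half i) - alpha m.+1 (iter d half i)./2) * c i)); last first.
  by move=> i _ /=; rewrite -mulrDl addrC subrK.
apply: le_trans (step_normD hX _ _ _) _; rewrite /= mulrDl lerD//.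
have := @step_norm_blocks m.+2 d (fun l => alpha m.+2 l - alpha m.+1 l./2) c.
by rewrite !addSn -addSn e.
Qed.

(** For every interval [I] of the finest level, [multiplier_point] is compared
    to [alpha I] times the difference of [1_I] and its mean. The deviation is
    paid along the branch of [I], the means by the mean of [|c|], and the
    combination of the [1_I] by the variation of [alpha] between levels. *)
Lemma multiplier_bound n (c : nat -> K) :
  rnorm (\sum_(i < 2 ^ n.+1) c i *: multiplier_point n.+1 i) <=
  \sum_(i < 2 ^ n.+1) snorm (c i) * path_dev n.+1 i (alpha n.+1 i) +
  \sum_(i < 2 ^ n.+1) (2 ^+ n.+1)^-1 * snorm (c i) * snorm (alpha n.+1 i) +
  level_var n * step_norm n.+1 c.
Proof.
set J1 := J (haar k None); pose q : K := of_real k (2 ^+ n.+1)^-1.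
pose dev i := multiplier_point n.+1 i - alpha n.+1 i *: (Jstep n.+1 (point i) - q *: J1).
have -> : \sum_(i < 2 ^ n.+1) c i *: multiplier_point n.+1 i =
    \sum_(i < 2 ^ n.+1) c i *: dev i -
    \sum_(i < 2 ^ n.+1) (q * c i * alpha n.+1 i) *: J1 +
    Jstep n.+1 (fun i => alpha n.+1 i * c i).
  have -> : Jstep n.+1 (fun i => alpha n.+1 i * c i) =
      \sum_(i < 2 ^ n.+1) (c i * alpha n.+1 i) *: Jstep n.+1 (point i).
    under eq_bigr do rewrite -(JstepZ hX).
    rewrite -(Jstep_sum hX); apply: eq_Jstep => t tn.
    rewrite (bigD1 (Ordinal tn))//= /point eqxx mulr1 mulrC big1 ?addr0// => i it.
    rewrite (_ : (t == i) = false) ?mulr0//.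
    by apply: contra_neqF it => /eqP ti; apply: val_inj.
  rewrite -sumrB -big_split /=; apply: eq_bigr => i _.
  exact: scale_split.
apply: le_trans (rnormD _ _) _; apply: lerD; last exact: step_norm_level_var.
apply: le_trans (rnormD _ _) _; rewrite rnormN; apply: lerD.
  apply: le_trans (rnorm_sum _ _ _) _; apply: ler_sum => i _.
  by rewrite rnormZ ler_wpM2l ?snorm_ge0// multiplier_point_dev.
apply: le_trans (rnorm_sum _ _ _) _; apply: ler_sum => i _.
rewrite rnormZ -/(haar_norm J None) (haar_norm_root hX) mulr1 !snormM snorm_of_real.
by rewrite ger0_norm// invr_ge0.
Qed.

End Family.
End Multiplier.

(** * Reduction to elementary tensors *)

Section Density.
Variables (R : realType) (k : scalar_kind).
Local Notation K := (scalar_field R k).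
Local Notation mu := (@lebesgue_measure R).
Local Notation I01 := (@unit_itv R).

Lemma in_L1_indic (A : set R) : measurable A -> in_L1 (\1_A : R -> K^o).
Proof.
move=> mA; split; first exact: smeas_indic.
apply: (@le_lt_trans _ _ (\int[mu]_(s in I01) (1%:E))%E).
  apply: ge0_le_integral => //.
  - by move=> s _; rewrite lee_fin rnorm_ge0.
  - by apply: smeas_ernorm; exact: smeas_indic.
  - by move=> s _; rewrite lee_fin; exact: snorm_indic_le1.
by rewrite integral_cst// mul1e [X in (X < _)%E](lebesgue_unit R) ltry.
Qed.

(** The approximating simple functions are cut off where their norm exceeds
    twice that of [u]; this keeps the pointwise convergence and gives a
    dominating function. *)
Lemma L1_simple_approx (V : normedModType K) (u : R -> V) (eta : R) :
  in_L1 u -> 0 < eta -> exists2 w, simple_function w &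
    (L1norm (fun s => w s - u s)%R < eta%:E)%E.
Proof.
move=> [su u1] eta0; have [w sw wu] := su.
pose E n := I01 `&` [set s | ((rnorm (w n s))%:E <= (2 * rnorm (u s))%:E)%E].
have mE n : measurable (E n).
  apply: measurable_lee => //; first by apply: smeas_ernorm; exact: smeas_simple.
  apply/measurable_EFinP; apply: measurable_funM => //; exact: smeas_rnorm.
pose w' n s := \1_(E n) s *: w n s.
have sw' n : simple_function (w' n).
  apply: (@simple_comp2 _ _ K^o V V (fun (a : K) x => a *: x)) (sw n).
  exists 1%N, (fun=> E n), (fun=> 1); split=> //.
  by apply/funext => s; rewrite big_ord1 /GRing.scale /= mulr1.
have sd n : strongly_measurable (fun s => w' n s - u s).
  rewrite (_ : (fun s => _) = (fun s => w' n s + (-1) *: u s)); last first.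
    by apply/funext => s; rewrite scaleN1r.
  by apply: smeasD; [exact: smeas_simple|exact: smeasZ].
have cv : (\int[mu]_(s in I01) (rnorm (w' n s - u s))%:E)%E @[n --> \oo] -->
          (\int[mu]_(s in I01) (cst 0 s))%E.
  apply: (@dominated_cvg _ _ _ mu I01 (@measurable_unit R)
      (fun n s => (rnorm (w' n s - u s))%:E) (cst 0%E) (fun s => (3 * rnorm (u s))%:E)).
  - by move=> n; exact: smeas_ernorm.
  - move=> s Is; apply: cvg_EFin; first by apply: nearW.
    apply/cvgrPdist_lt => e e0.
    have [us0|us0] := eqVneq (rnorm (u s)) 0.
      apply: nearW => n; rewrite sub0r normrN.
      rewrite /= (rnorm0_eq0 us0) subr0 /w' indicE; case: (boolP (s \in E n)).
        rewrite inE => -[_ /=]; rewrite us0 mulr0 lee_fin => h.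
        have -> : w n s = 0 by apply: rnorm0_eq0; apply/eqP; rewrite eq_le h rnorm_ge0.
        by rewrite scaler0 rnorm0 normr0.
      by rewrite scale0r rnorm0 normr0.
    have upos : 0 < rnorm (u s) by rewrite lt_neqAle eq_sym us0 rnorm_ge0.
    have m0 : 0 < Num.min e (rnorm (u s)) by rewrite lt_min e0 upos.
    have /cvg_rnormP /(_ _ m0) [N hN] := wu s Is.
    near=> n; rewrite sub0r normrN /= ger0_norm ?rnorm_ge0//.
    have /hN : (N <= n)%N by near: n; exists N.
    rewrite lt_min => /andP[h1 h2].
    rewrite /w' indicE mem_set ?scale1r//; split=> //=; rewrite lee_fin.
    have := rnormD (w n s - u s) (u s); rewrite subrK; lra.
  - by [].
  - apply/integrableP; split.
      by apply/measurable_EFinP; apply: measurable_funM => //; exact: smeas_rnorm.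
    rewrite (_ : (\int[_]_(_ in _) _)%E = (3%:E * L1norm u)%E).
      by rewrite lte_mul_pinfty// lee_fin.
    rewrite /L1norm -ge0_integralZl_EFin//.
    + by apply: eq_integral => s _; rewrite /= ger0_norm// mulr_ge0// rnorm_ge0.
    + by move=> s _; rewrite lee_fin rnorm_ge0.
    + exact: smeas_ernorm.
  - move=> n s Is /=; rewrite lee_fin ger0_norm ?rnorm_ge0//.
    have := rnormD (w' n s) (- u s); rewrite rnormN => h; apply: le_trans h _.
    suff : rnorm (w' n s) <= 2 * rnorm (u s) by lra.
    rewrite /w' indicE; case: (boolP (s \in E n)) => [|_].
      by rewrite inE => -[_ /=]; rewrite lee_fin scale1r.
    by rewrite scale0r rnorm0 mulr_ge0// rnorm_ge0.
rewrite integral0 in cv.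
have e0 : (0 < eta%:E :> \bar R)%E by rewrite lte_fin.
have : \forall n \near \oo, ((\int[mu]_(s in I01) (rnorm (w' n s - u s))%:E)%E < eta%:E)%E.
  exact: (cv _ (open_ereal_lt' e0)).
by case=> N _ /(_ N (leqnn N)) h; exists (w' N).
Unshelve. all: by end_near. Qed.

Lemma L1norm_split (V : normedModType K) (I : finType) (A : I -> set R) (y : I -> V) :
  (forall i, measurable (A i)) -> (forall i j s, A i s -> A j s -> i = j) ->
  (L1norm (fun s => \sum_i tensor (\1_(A i)) (y i) s)%R =
   \sum_i L1norm (tensor (\1_(A i) : R -> K) (y i)))%E.
Proof.
move=> mA tA; rewrite /L1norm -ge0_integral_sum//; last 2 first.
- by move=> i; apply: smeas_ernorm; apply: smeas_tensor; exact: smeas_indic.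
- by move=> i s _; rewrite lee_fin rnorm_ge0.
apply: eq_integral => s _; rewrite sumEFin; congr EFin.
have [[i Ai]|nA] := pselect (exists i, A i s).
  have z j : j != i -> tensor (\1_(A j)) (y j) s = 0 :> V.
    move=> ji; rewrite /tensor indicE memNset ?scale0r// => Aj.
    by move/eqP: ji; apply; exact: (tA _ _ s).
  rewrite (bigD1 i)//= (bigD1 (P := xpredT) i)//= !big1 ?addr0//.
  by move=> j ji; rewrite z// rnorm0.
rewrite !big1 ?rnorm0// => i _.
  by rewrite /tensor indicE memNset ?scale0r ?rnorm0// => Ai; apply: nA; exists i.
by rewrite /tensor indicE memNset ?scale0r// => Ai; apply: nA; exists i.
Qed.

(** L_1(V) is a projective tensor product: the norm of a bounded operator is
    determined by the elementary tensors of indicator functions. *)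
Lemma L1opnorm_le_elementary (V W : normedModType K) (D : (R -> V) -> (R -> W))
    (Y : set V) (c : R) :
  dense Y -> bounded_L1op D -> 0 <= c ->
  (forall (A : set R) y, measurable A -> Y y ->
     (L1norm (D (tensor (\1_A) y)) <= c%:E * L1norm (tensor (\1_A : R -> K) y))%E) ->
  (L1opnorm D <= c%:E)%E.
Proof.
move=> dY bD c0 hD; apply: ub_ereal_sup => _ [u [u1 nu] <-].
apply/lee_addgt0Pr => e e0.
have [C hC] := L1op_bounded bD.
(* [D] is bounded by [C] on the error [u - v], of norm at most [2 * eta], and
   the norm of [v] exceeds that of [u] by at most [2 * eta]. *)
pose eta := e / (2 * (`|C| + c + 1)).
have den : 0 < 2 * (`|C| + c + 1) by rewrite mulr_gt0// ltr_wpDl// addr_ge0.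
have eta0 : 0 < eta by rewrite divr_gt0.
have [w sw wu] := L1_simple_approx u1 eta0.
have [I [A [x [mA cA tA wA]]]] := simple_partition sw.
have hy i : exists y, Y y /\ rnorm (x i - y) < eta.
  by have [y Yy xy] := dense_rnorm dY (x i) eta0; exists y.
have [y hyP] := choice hy.
pose v s := \sum_i tensor (\1_(A i)) (y i) s.
have t1 i : in_L1 (tensor (\1_(A i) : R -> K) (y i)).
  by apply: in_L1_tensor; exact: in_L1_indic.
have v1 : in_L1 v by apply: (in_L1_sum (index_enum I) t1).
have d1 : in_L1 (fun s => u s - v s) by exact: in_L1B.
have dn : (L1norm (fun s => u s - v s)%R <= (2 * eta)%:E)%E.
  have sdw : strongly_measurable (fun s => w s - u s).
    rewrite (_ : (fun s => _) = (fun s => w s + (-1) *: u s)); last first.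
      by apply/funext => s; rewrite scaleN1r.
    by apply: smeasD; [exact: smeas_simple|apply: smeasZ; exact: u1.1].
  apply: (@le_trans _ _ (\int[mu]_(s in I01) ((rnorm (w s - u s))%:E + eta%:E))%E).
    apply: ge0_le_integral => //.
    - by move=> s _; rewrite lee_fin rnorm_ge0.
    - exact: smeas_ernorm d1.1.
    - by apply: emeasurable_funD => //; exact: smeas_ernorm.
    - move=> s _; rewrite -EFinD lee_fin.
      have [i Ai] := cA s.
      have vs : v s = y i.
        rewrite /v (bigD1 i)//= big1 ?addr0; first by rewrite /tensor indicE mem_set// scale1r.
        move=> j ji; rewrite /tensor indicE memNset ?scale0r// => Aj.
        by move/eqP: ji; apply; exact: (tA _ _ s).
      have := (hyP i).2; rewrite -vs -(wA _ _ Ai) => h.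
      by have := rnorm_subD (u s) (w s) (v s); rewrite (rnormB (u s) (w s)); lra.
  rewrite ge0_integralD//; last 3 first.
  - by move=> s _; rewrite lee_fin rnorm_ge0.
  - exact: smeas_ernorm.
  - by move=> s _; rewrite lee_fin ltW.
  rewrite integral_cst// [X in (_ * X)%E](lebesgue_unit R) mule1 mulrDl mul1r EFinD.
  by rewrite leeD// ltW.
have Du : (L1norm (D u) <= L1norm (D (fun s => u s - v s)%R) + L1norm (D v))%E.
  have sD1 := (L1op_in_L1 bD d1).1; have sDv := (L1op_in_L1 bD v1).1.
  rewrite (@L1norm_ae _ _ _ _ (fun s => D (fun s => u s - v s) s + D v s)).
  - exact: L1normD.
  - exact: (L1op_in_L1 bD u1).1.
  - exact: smeasD.
  - have := L1opD bD d1 v1; rewrite (_ : (fun s => _) = u)//.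
    by apply/funext => s; rewrite subrK.
have Dv : (L1norm (D v) <= c%:E * L1norm v)%E.
  rewrite [in leRHS]/v L1norm_split// ge0_sume_distrr; last by move=> i _; exact: L1norm_ge0.
  have Dti i : in_L1 (D (tensor (\1_(A i)) (y i))) by exact: (L1op_in_L1 bD).
  rewrite (L1norm_ae (L1op_in_L1 bD v1).1 _ (L1op_sum bD (index_enum I) t1)); last first.
    exact: (in_L1_sum _ Dti).1.
  apply: (@le_trans _ _ (\sum_i L1norm (D (tensor (\1_(A i)) (y i))))%E).
    elim: (index_enum I) => [|i r IH].
      rewrite big_nil; under eq_fun do rewrite big_nil.
      by rewrite L1norm0.
    rewrite big_cons; under [X in L1norm X]eq_fun do rewrite big_cons.
    apply: le_trans (L1normD (Dti i).1 (in_L1_sum r Dti).1) _.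
    by rewrite leeD2l.
  by apply: lee_sum => i _; apply: hD => //; exact: (hyP i).1.
have nv : (L1norm v <= 1 + (2 * eta)%:E)%E.
  have sN : strongly_measurable (fun s => (-1) *: (u s - v s)) by exact: smeasZ d1.1.
  have -> : L1norm v = L1norm (fun s => u s + (-1) *: (u s - v s)).
    by congr L1norm; apply/funext => s; rewrite scaleN1r opprB addrC subrK.
  apply: le_trans (L1normD u1.1 sN) _; rewrite leeD// L1normZ; last exact: d1.1.
  by rewrite -of_real1 -of_realN snorm_of_real normrN1 mul1e.
have Dd : (L1norm (D (fun s => u s - v s)%R) <= `|C|%:E * (2 * eta)%:E)%E.
  apply: le_trans (hC _ d1) _.
  apply: (@le_trans _ _ (`|C|%:E * L1norm (fun s => u s - v s)%R)%E).
    by rewrite lee_wpmul2r ?L1norm_ge0// lee_fin ler_norm.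
  by rewrite lee_wpmul2l// lee_fin.
apply: le_trans Du _; apply: le_trans (leeD Dd Dv) _.
apply: (@le_trans _ _ (`|C|%:E * (2 * eta)%:E + c%:E * (1 + (2 * eta)%:E))%E).
  by rewrite leeD2l// lee_wpmul2l// lee_fin.
suff : `|C| * (2 * eta) + c * (1 + 2 * eta) <= c + e by rewrite -lee_fin.
have -> : e = 2 * (`|C| + c + 1) * eta by rewrite /eta mulrC divfK// gt_eqF.
have := normr_ge0 C; nra.
Qed.

End Density.

(** * Integration of the pointwise estimate *)

Section IntegralBounds.
Variable R : realType.
Local Notation mu := (@lebesgue_measure R).
Local Notation I01 := (@unit_itv R).

(** Carrying measurability and sign along with the bound lets the integral of
    the estimate follow the recursive shape of its terms. *)
Definition int_le (B : R -> R) (b : R) : Prop :=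
  [/\ measurable_fun I01 B, forall s, 0 <= B s &
      (\int[mu]_(s in I01) (B s)%:E <= b%:E)%E].

Lemma int_le0 : int_le (fun=> 0) 0.
Proof.
split=> //.
by rewrite (_ : (\int[_]_(_ in _) _)%E = 0%E)// integral0.
Qed.

Lemma int_leD B B' b b' : int_le B b -> int_le B' b' ->
  int_le (fun s => B s + B' s) (b + b').
Proof.
move=> [mB B0 Bb] [mB' B0' Bb']; split.
- exact: measurable_funD.
- by move=> s; rewrite addr_ge0.
- under eq_integral do rewrite EFinD.
  rewrite ge0_integralD// ?EFinD ?leeD//.
  + by move=> s _; rewrite lee_fin.
  + exact/measurable_EFinP.
  + by move=> s _; rewrite lee_fin.
  + exact/measurable_EFinP.
Qed.

Lemma int_leZ a B b : 0 <= a -> int_le B b -> int_le (fun s => a * B s) (a * b).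
Proof.
move=> a0 [mB B0 Bb]; split.
- exact: measurable_funM.
- by move=> s; rewrite mulr_ge0.
- under eq_integral do rewrite EFinM.
  rewrite ge0_integralZl_EFin//.
  + by rewrite EFinM lee_wpmul2l.
  + by move=> s _; rewrite lee_fin.
  + exact/measurable_EFinP.
Qed.

Lemma int_le_sum (I : Type) (r : seq I) (B : I -> R -> R) (b : I -> R) :
  (forall i, int_le (B i) (b i)) ->
  int_le (fun s => \sum_(i <- r) B i s) (\sum_(i <- r) b i).
Proof.
move=> h; elim: r => [|i r IH].
  by rewrite big_nil; under eq_fun do rewrite big_nil; exact: int_le0.
by rewrite big_cons; under eq_fun do rewrite big_cons; exact: int_leD.
Qed.

Lemma int_le_weaken B b b' : b <= b' -> int_le B b -> int_le B b'.
Proof. by move=> bb' [mB B0 Bb]; split=> //; apply: le_trans Bb _; rewrite lee_fin. Qed.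

Lemma int_le_norm k (V : normedModType (scalar_field R k)) (u : R -> V) b :
  strongly_measurable u -> (L1norm u <= b%:E)%E -> int_le (fun s => rnorm (u s)) b.
Proof. by move=> su ub; split=> //; [exact: smeas_rnorm|move=> s; exact: rnorm_ge0]. Qed.

End IntegralBounds.

Section DyadicInclusion.
Variable R : realType.

Lemma node_sub n d i : (i < 2 ^ (n + d))%N ->
  haar_sub R (node (n + d) i) (node n (iter d half i)).
Proof.
move=> ilt; rewrite !nodeE; first exact: iter_half_lt.
move=> jlt; rewrite /haar_sub /dyadic_set /= => s si.
have s0 := dyadic_itv_ge0 si; apply/(dyadic_itvP _ _ s0).
move/(dyadic_itvP _ _ s0): si <-; elim: d {i ilt jlt} => [|d IH]; first by rewrite addn0.
by rewrite addnS iterSr -dyadic_posS.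
Qed.

Lemma node_length n i : (i < 2 ^ n)%N -> haar_length R (node n i) = (2 ^+ n)^-1.
Proof. by move=> ilt; rewrite nodeE. Qed.

End DyadicInclusion.

Section Main.
Variables (R : realType) (k : scalar_kind).
Local Notation K := (scalar_field R k).
Variables (X : completeNormedModType K) (J : (R -> K) -> X).
Hypothesis hX : haar_system_space J.
Variable T : (R -> X) -> (R -> X).
Hypothesis hT : X_diagonal J T.
Variable TD : haar_index -> (R -> K^o) -> (R -> K^o).
Hypothesis hTD : forall L, is_entry J T L L (TD L).
Variable eps : R.
Hypothesis eps0 : 0 < eps.
Hypothesis hclose : forall L M : haar_index, haar_sub R L M ->
  (L1opnorm (L1op_sub (TD L) (TD M)) <= (eps * haar_length R M ^+ 2)%:E)%E.
Variable S : (R -> X) -> (R -> X).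
Hypothesis hS : is_tensor_id (TD None) S.

Local Notation D := (L1op_sub T S).
Local Notation H n i := (J (haar k (node n i))).

Variable f : R -> K.
Hypothesis f1 : in_L1 (f : R -> K^o).
Let r : R := fine (L1norm (f : R -> K^o)).
Let alpha (s : R) (n i : nat) : K := TD (node n i) f s - TD None f s.

Lemma bounded_D : bounded_L1op D.
Proof. exact: L1op_sub_bounded hT.1 hS.1. Qed.

Lemma L1norm_r : L1norm (f : R -> K^o) = r%:E.
Proof. by rewrite fineK// L1norm_fin. Qed.

Lemma entry_dist L M : haar_sub R L M ->
  int_le (fun s => snorm (TD L f s - TD M f s)) (eps * r * haar_length R M ^+ 2).
Proof.
move=> LM; have bD := L1op_sub_bounded (hTD L).1 (hTD M).1.
apply: (@int_le_norm R k K^o (fun s => TD L f s - TD M f s)).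
  exact: (L1op_in_L1 bD f1).1.
have := L1opnorm_bound bD (hclose LM) f1.
by rewrite L1norm_r -EFinM mulrAC.
Qed.

Lemma D_haar n i :
  ae_eq_fun (D (tensor f (H n i))) (fun s => alpha s n i *: H n i).
Proof.
have hd := diagonal_haar hX hT hTD (node n i) f1.
have hs := hS.2 f (H n i) f1.
move: hd hs; apply: ae_imp2 => s h1 h2 Is.
by rewrite /L1op_sub h1// h2// /tensor /alpha scalerBl.
Qed.

Lemma D_point n i : (i < 2 ^ n)%N ->
  ae_eq_fun (D (tensor f (Jstep J n (point R k i)))) (fun s => multiplier_point J (alpha s) n i).
Proof.
elim: n i => [|n IH] i ilt.
  have -> : Jstep J 0 (point R k i) = J (haar k None).
    rewrite haar_root; apply: eq_Jstep => -[] // _.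
    by move: ilt; rewrite expn0 ltnS leqn0 => /eqP ->.
  have hd := diagonal_haar hX hT hTD None f1.
  have hs := hS.2 f (J (haar k None)) f1.
  move: hd hs; apply: ae_imp2 => s h1 h2 Is.
  by rewrite /L1op_sub h1// h2// subrr.
rewrite (Jstep_pointS hX ilt) /=.
set p := Jstep J n _; set h := H n i./2; set o := _ ^+ odd i.
have bD := bounded_D; have hp := in_L1_tensor p f1; have hh := in_L1_tensor h f1.
have -> : tensor f (2^-1 *: (p + o *: h)) =
    (fun s => 2^-1 *: (o *: tensor f h s + tensor f p s)).
  by apply/funext => s; rewrite /tensor addrC !scalerDr !scalerA; congr (_ *: _ + _ *: _); ring.
have e1 := L1opZ bD 2^-1 (in_L1D (in_L1Z o hh) hp).
have e2 := L1op_linear bD o hh hp.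
have e3 := D_haar n i./2; have e4 := IH _ (half_lt ilt).
apply: (ae_eq_fun_trans e1); apply: ae_eq_funZ; apply: (ae_eq_fun_trans e2).
move: e3 e4; apply: ae_imp2 => s h3 h4 Is.
by rewrite h3// h4// addrC.
Qed.

Lemma D_step n (c : nat -> K) :
  ae_eq_fun (D (tensor f (Jstep J n c)))
            (fun s => \sum_(i < 2 ^ n) c i *: multiplier_point J (alpha s) n i).
Proof.
have bD := bounded_D.
have hp (i : 'I_(2 ^ n)) := in_L1_tensor (Jstep J n (point R k i)) f1.
have -> : tensor f (Jstep J n c) =
    (fun s => \sum_(i < 2 ^ n) c i *: tensor f (Jstep J n (point R k i)) s).
  apply/funext => s; rewrite /tensor.
  under eq_bigr do rewrite scalerA mulrC -scalerA -(JstepZ hX).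
  rewrite -scaler_sumr -(Jstep_sum hX); congr (_ *: _); apply: eq_Jstep => t tn.
  rewrite (bigD1 (Ordinal tn))//= /point eqxx mulr1 big1 ?addr0// => i it.
  rewrite (_ : (t == i) = false) ?mulr0//.
  by apply: contra_neqF it => /eqP ti; apply: val_inj.
have hcp (i : 'I_(2 ^ n)) := in_L1Z (c i) (hp i).
have e := L1op_sum bD (index_enum 'I_(2 ^ n)) hcp.
apply: (ae_eq_fun_trans e).
have : {ae @lebesgue_measure R, forall s, forall i : 'I_(2 ^ n), unit_itv s ->
    D (fun s => c i *: tensor f (Jstep J n (point R k i)) s) s = c i *: multiplier_point J (alpha s) n i}.
  apply: ae_forall_count => i.
  have e1 := L1opZ bD (c i) (hp i); have e2 := D_point (ltn_ord i).
  by move: e1 e2; apply: ae_imp2 => s h1 h2 Is; rewrite h1// h2.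
by apply: ae_imp => s h Is; apply: eq_bigr => i _; rewrite h.
Qed.

Lemma r_ge0 : 0 <= r. Proof. by rewrite fine_ge0// L1norm_ge0. Qed.

Lemma int_alpha n i : int_le (fun s => snorm (alpha s n i)) (eps * r).
Proof.
have h : haar_sub R (node n i) None by case: (node n i).
by have := entry_dist h; rewrite expr1n mulr1.
Qed.

Lemma int_alphaB n d i : (i < 2 ^ (n + d))%N ->
  int_le (fun s => snorm (alpha s (n + d) i - alpha s n (iter d half i))) (eps * r * (4 ^+ n)^-1).
Proof.
move=> ilt; have := entry_dist (node_sub R ilt).
rewrite node_length; last exact: iter_half_lt.
rewrite exprVn -exprM mulnC exprM (_ : 2 ^+ 2 = 4 :> R); last by rewrite expr2; ring.
congr int_le; apply/funext => s; congr snorm.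
by rewrite /alpha opprB addrA subrK.
Qed.

(** The ancestor of level [m] contributes [2 ^ m / 2 ^ N] times [4 ^ - m], a
    geometric series of sum less than [2 / 2 ^ N]. *)
Lemma int_path_dev N i : (i < 2 ^ N)%N ->
  int_le (fun s => path_dev (alpha s) N i (alpha s N i)) (eps * r * (2 * (2 ^+ N)^-1)).
Proof.
move=> iN; have er0 : 0 <= eps * r by rewrite mulr_ge0 ?r_ge0// ltW.
(* the exact partial sum, which carries the induction *)
suff h n d : (n + d = N)%N ->
    int_le (fun s => path_dev (alpha s) n (iter d half i) (alpha s N i))
           (eps * r * (2 * (2 ^+ n)^-1 - 2 * (4 ^+ n)^-1)).
  apply: int_le_weaken (h N 0 (addn0 N)).
  by rewrite ler_wpM2l// gerBl mulr_ge0// invr_ge0 exprn_ge0.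
elim: n d => [|n IH] d e.
  rewrite !expr0 subrr mulr0; exact: int_le0.
have hd := IH d.+1; rewrite addnS -addSn in hd; have {}hd := hd e.
have ilt : (i < 2 ^ (n + d.+1))%N by rewrite addnS -addSn e.
have ha := int_alphaB ilt; rewrite addnS -addSn e in ha.
have := int_leZ (a := 2^-1) _ (int_leD hd ha); rewrite invr_ge0 => /(_ (ler0n _ _)).
rewrite [X in int_le _ X -> _](_ : _ = eps * r * (2 * (2 ^+ n.+1)^-1 - 2 * (4 ^+ n.+1)^-1)).
  congr int_le; apply/funext => s /=; congr (_ * (_ + _)).
  by rewrite !snormE (@rnormB _ _ K^o).
rewrite !exprS !invfM; set x := (2 ^+ n)^-1; set y := (4 ^+ n)^-1; by field.
Qed.

(** The [2 ^ (m + 2)] intervals of level [m + 2] contribute [4 ^ - (m + 1)]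
    each, so that the levels from 2 on add up to less than 2, as much as level
    1 contributes. *)
Lemma int_level_var n :
  int_le (fun s => level_var (alpha s) n) (eps * r * (4 - 2 * (2 ^+ n)^-1)).
Proof.
elim: n => [|n IH].
  rewrite expr0 invr1 /=.
  have := int_le_sum (index_enum 'I_(2 ^ 1)) (fun i => int_alpha 1 i).
  by rewrite sumr_const card_ord => h; apply: int_le_weaken h; rewrite -mulr_natl; lra.
have hb (l : 'I_(2 ^ n.+2)) : int_le (fun s => snorm (alpha s n.+2 l - alpha s n.+1 l./2))
    (eps * r * (4 ^+ n.+1)^-1).
  have ll : (l < 2 ^ (n.+1 + 1))%N by rewrite addn1.
  by have := int_alphaB ll; rewrite addn1.
have := int_leD IH (int_le_sum (index_enum 'I_(2 ^ n.+2)) hb).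
congr int_le; rewrite sumr_const card_ord -(mulr_natl (eps * r * _)) natrX !exprS !invfM.
rewrite (_ : 4 ^+ n = 2 ^+ n * 2 ^+ n :> R); last by rewrite -exprMn; congr (_ ^+ _); ring.
rewrite invfM; have : 2 ^+ n != 0 :> R by rewrite gt_eqF.
set x := 2 ^+ n => x0; by field.
Qed.

(** The constant is [2 + 1 + 4], for the three terms of [multiplier_bound]. *)
Lemma elementary_bound n (c : nat -> K) :
  (L1norm (D (tensor f (Jstep J n.+1 c))) <= (7 * eps)%:E * L1norm (tensor f (Jstep J n.+1 c)))%E.
Proof.
have er0 : 0 <= eps * r by rewrite mulr_ge0 ?r_ge0// ltW.
rewrite (L1norm_tensor _ f1.1) L1norm_r -!EFinM -/(step_norm J n.+1 c).
pose N := n.+1.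
have iA : int_le (fun s => \sum_(i < 2 ^ N) snorm (c i) * path_dev (alpha s) N i (alpha s N i))
    (\sum_(i < 2 ^ N) snorm (c i) * (eps * r * (2 * (2 ^+ N)^-1))).
  by apply: int_le_sum => i; apply: int_leZ; [exact: snorm_ge0|exact: int_path_dev].
have iB : int_le (fun s => \sum_(i < 2 ^ N) (2 ^+ N)^-1 * snorm (c i) * snorm (alpha s N i))
    (\sum_(i < 2 ^ N) (2 ^+ N)^-1 * snorm (c i) * (eps * r)).
  apply: int_le_sum => i; apply: int_leZ; last exact: int_alpha.
  by rewrite mulr_ge0 ?snorm_ge0// invr_ge0.
have iC := int_leZ (step_norm_ge0 J N c) (int_level_var n).
have [mB B0 Bb] := int_leD (int_leD iA iB) iC.
have sD := (L1op_in_L1 bounded_D (in_L1_tensor (Jstep J N c) f1)).1.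
apply: (@le_trans _ _ (\int[lebesgue_measure]_(s in @unit_itv R)
   ((\sum_(i < 2 ^ N) snorm (c i) * path_dev (alpha s) N i (alpha s N i) +
     \sum_(i < 2 ^ N) (2 ^+ N)^-1 * snorm (c i) * snorm (alpha s N i)) +
     step_norm J N c * level_var (alpha s) n)%:E)%E).
  apply: ae_ge0_le_integral => //.
  - by move=> s _; rewrite lee_fin rnorm_ge0.
  - exact: smeas_ernorm.
  - by move=> s _; rewrite lee_fin.
  - exact/measurable_EFinP.
  - have := D_step N c; apply: ae_imp => s h Is.
    rewrite h// lee_fin [step_norm J N c * _]mulrC; exact: (multiplier_bound hX).
apply: le_trans Bb _; rewrite lee_fin.
have mean := step_norm_mean hX N c; rewrite avgn_mean in mean.
set m := _ * \sum_(i < _) _ in mean.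
have -> : \sum_(i < 2 ^ N) snorm (c i) * (eps * r * (2 * (2 ^+ N)^-1)) = 2 * (eps * r) * m.
  by rewrite /m /absf -mulr_suml; ring.
have -> : \sum_(i < 2 ^ N) (2 ^+ N)^-1 * snorm (c i) * (eps * r) = eps * r * m.
  by rewrite /m /absf -mulr_suml -mulr_sumr; ring.
have j0 := step_norm_ge0 J N c.
have h1 : eps * r * m <= eps * r * step_norm J N c by rewrite ler_wpM2l.
have h2 : step_norm J N c * (eps * r * (4 - 2 * (2 ^+ n)^-1)) <= 4 * (eps * r * step_norm J N c).
  rewrite [leRHS](_ : _ = step_norm J N c * (eps * r * 4)); last by ring.
  by rewrite !ler_wpM2l// gerBl mulr_ge0// invr_ge0.
rewrite [leRHS](_ : _ = 7 * (eps * r * step_norm J N c)); last by rewrite /N; ring.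
lra.
Qed.

End Main.

Theorem proposition6p2 (R : realType) (k : scalar_kind)
  (X : completeNormedModType (scalar_field R k)) (J : (R -> scalar_field R k) -> X)
  (hX : haar_system_space J)
  (T : (R -> X) -> (R -> X)) (hT : X_diagonal J T)
  (TD : haar_index -> (R -> (scalar_field R k)^o) -> (R -> (scalar_field R k)^o))
  (hTD : forall L : haar_index, is_entry J T L L (TD L))
  (eps : R) (heps : 0 < eps)
  (hclose : forall L M : haar_index, haar_sub R L M ->
     (L1opnorm (L1op_sub (TD L) (TD M)) <= (eps * haar_length R M ^+ 2)%:E)%E)
  (S : (R -> X) -> (R -> X)) (hS : is_tensor_id (TD None) S) :
  (L1opnorm (L1op_sub T S) <= (7 * eps)%:E)%E.
Proof.
apply: (L1opnorm_le_elementary (hss_dense hX)).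
- exact: L1op_sub_bounded hT.1 hS.1.
- by rewrite mulr_ge0// ltW.
- move=> A _ mA [_ /dyadic_stepP[m [c ->]] <-].
  rewrite -/(Jstep J m c) JstepS.
  exact: (elementary_bound hX hT hTD heps hclose hS (in_L1_indic k mA)).
Qed.
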